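(* Let $C\subset\mathbb{R}^n$ be a proper, homogeneous, and self-dual cone. Let $A\in M(C)$ be Hurwitz. Then there exists a symmetric matrix $P\in\mathbb{R}^{n\times n}$ such that $P: C\to C^\vee=C$ is an automorphism of $C$ (that is, $P\in\operatorname{Aut}(C)$), and the quadratic form $x^TPx$ is a Lyapunov function for the linear dynamical system $\dot x(t)=Ax(t)$.
   Context: A set $C\subset\mathbb{R}^n$ is a cone if $x\in C$ implies $\alpha x\in C$ for all $\alpha>0$. A cone is proper if it is closed, convex, pointed ($x\in C$ and $-x\in C$ imply $x=0$), and has nonempty interior. The dual cone is $C^\vee=\{y\in\mathbb{R}^n \mid y^Tx\ge 0 \text{ for all } x\in C\}$, and $C$ is self-dual if $C^\vee=C$. $\operatorname{Aut}(C)$ is the group of all linear maps (matrices) $\phi:\mathbb{R}^n\to\mathbb{R}^n$ such that $\phi(C)=C$. The cone $C$ is homogeneous if for any two points $x,y\in\operatorname{int}(C)$ there exists $L\in\operatorname{Aut}(C)$ such that $Lx=y$. $M(C)$ is the set of matrices $A\in\mathbb{R}^{n\times n}$ such that $C$ is an invariant set of $\dot x(t)=Ax(t)$, i.e. $x(0)\in C$ implies $x(t)=\exp(At)x(0)\in C$ for all $t\ge 0$. A matrix is Hurwitz if all its eigenvalues have negative real part. For a symmetric matrix $P$, the quadratic form $x^TPx$ is a Lyapunov function for $\dot x=Ax$ if $P$ is positive-definite and $PA+A^TP$ is negative-definite. *)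

(* Defs.v *)
From HB Require Import structures.
From mathcomp Require Import all_boot all_order all_algebra.
From mathcomp Require Import boolp classical_sets reals topology normedtype.
From mathcomp Require Import sequences convex.
From mathcomp Require Import complex.

Set Implicit Arguments.
Unset Strict Implicit.
Unset Printing Implicit Defensive.

Import Order.TTheory GRing.Theory Num.Theory.
Import numFieldNormedType.Exports.

Local Open Scope classical_set_scope.
Local Open Scope ring_scope.

Section Cones.
Variables (R : realType) (n : nat).
Implicit Types (C : set 'cV[R]_n) (A P : 'M[R]_n).

Definition is_cone C := forall x (a : R), C x -> 0 < a -> C (a *: x).

Definition pointed_cone C := forall x, C x -> C (- x) -> x = 0.

Definition proper_cone C :=
  [/\ is_cone C, closed C, convex_set C, pointed_cone C & C° !=set0].

Definition dual_cone C : set 'cV[R]_n :=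
  [set y | forall x, C x -> 0 <= (y^T *m x) 0 0].

Definition self_dual C := dual_cone C = C.

(* Invertibility is not required separately: if [C] has nonempty interior, it
   spans the space, and [F C = C] forces [F] to be invertible. *)
Definition Aut_cone C : set 'M[R]_n := [set F | mulmx F @` C = C].

Definition homogeneous_cone C :=
  forall x y, C° x -> C° y -> exists2 L, Aut_cone C L & L *m x = y.

(* The limit is taken in the normed space of matrices. *)
Definition expmx A : 'M[R]_n :=
  limn (series (fun k => (k`!%:R : R)^-1 *: A ^+ k)).

(* The set M(C): [x t = expmx (t *: A) *m x 0] is the solution of x' = A x. *)
Definition invariant_dynamics C : set 'M[R]_n :=
  [set A | forall x, C x -> forall t : R, 0 <= t -> C (expmx (t *: A) *m x)].

(* The eigenvalues are the complex ones. *)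
Definition hurwitz A :=
  forall z : complex R,
    eigenvalue (map_mx (real_complex R) A) z -> complex.Re z < 0.

Definition posdefmx P :=
  forall x : 'cV[R]_n, x != 0 -> 0 < (x^T *m P *m x) 0 0.

Definition negdefmx P :=
  forall x : 'cV[R]_n, x != 0 -> (x^T *m P *m x) 0 0 < 0.

(* Intended for symmetric [P]; the candidate function is x^T P x. *)
Definition lyapunov_form A P :=
  posdefmx P /\ negdefmx (P *m A + A^T *m P).

End Cones.

(* Main.v *)
(** Let G be the automorphism group of C; it is closed under transposition because C
    is self-dual. By homogeneity, w = g e |-> ln |det g| is a function on the interior
    of C for any interior point e. Maximizing |det g| first under a linear and then
    under a quadratic constraint shows that this function is concave and yields a
    point e at which its gradient is e itself. The map g e |-> g^-T e (minus the
    gradient of the barrier, a stand-in for Jordan algebra inversion) is then a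
    well-defined antitone involution, Lipschitz near e, and antitonicity together
    with involutivity forces its derivative at e to be -1 in the directions where it
    is almost affine. Given interior points x and z, a minimizer g of
    <g x, e> + <z, g^-1 e> therefore satisfies g x = g^-T z, so that P = g^T g is a
    positive definite automorphism with P x = z.

    Since A is cross-positive and has no eigenvalue >= 0, there is an interior x with
    -A x interior, and likewise z for A^T. With g as above, M = g A g^-1 + (g A g^-1)^T
    is symmetric and cross-positive and -M (g x) is interior; as for M-matrices this
    excludes eigenvalues >= 0, so M is negative definite, and so is
    P A + A^T P = g^T M g. *)

From mathcomp Require Import all_boot all_order all_algebra.
From mathcomp Require Import boolp classical_sets reals.
From mathcomp Require Import topology normedtype sequences derive exp complex.
From mathcomp Require Import ring lra.
Require Import Defs.

Set Implicit Arguments.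
Unset Strict Implicit.
Unset Printing Implicit Defensive.

Import Order.TTheory GRing.Theory Num.Theory.
Import numFieldNormedType.Exports.

Local Open Scope classical_set_scope.
Local Open Scope ring_scope.

(** * Euclidean geometry and compactness of sets of matrices *)

Section Euclidean.
Variables (R : realType) (n : nat).
Implicit Types (u v w : 'cV[R]_n) (A : 'M[R]_n) (a : R).

Definition dot u v : R := (u^T *m v) 0 0.

Lemma dotE u v : dot u v = \sum_i u i 0 * v i 0.
Proof. by rewrite /dot mxE; apply: eq_bigr => i _; rewrite mxE. Qed.

Lemma dotC u v : dot u v = dot v u.
Proof. by rewrite !dotE; apply: eq_bigr => i _; rewrite mulrC. Qed.

Lemma dotDr u v w : dot u (v + w) = dot u v + dot u w.
Proof. by rewrite /dot mulmxDr mxE. Qed.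

Lemma dotZr a u v : dot u (a *: v) = a * dot u v.
Proof. by rewrite /dot -scalemxAr mxE. Qed.

Lemma dotNr u v : dot u (- v) = - dot u v.
Proof. by rewrite -scaleN1r dotZr mulN1r. Qed.

Lemma dotDl u v w : dot (v + w) u = dot v u + dot w u.
Proof. by rewrite dotC dotDr !(dotC u). Qed.

Lemma dotZl a u v : dot (a *: v) u = a * dot v u.
Proof. by rewrite dotC dotZr dotC. Qed.

Lemma dotNl u v : dot (- v) u = - dot v u.
Proof. by rewrite dotC dotNr dotC. Qed.

Definition dot_bilin := (dotDr, dotDl, dotNr, dotNl, dotZr, dotZl).

Lemma dot_sqrD u v : dot (u + v) (u + v) = dot u u + 2 * dot u v + dot v v.
Proof. by rewrite !dot_bilin (dotC v u); ring. Qed.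

Lemma dot0r u : dot u 0 = 0.
Proof. by rewrite -(scale0r 0) dotZr mul0r. Qed.

Lemma dot_mulmxr A u v : dot u (A *m v) = dot (A^T *m u) v.
Proof. by rewrite /dot trmx_mul trmxK mulmxA. Qed.

Lemma dot_mulmxl A u v : dot (A *m u) v = dot u (A^T *m v).
Proof. by rewrite dot_mulmxr trmxK. Qed.

Lemma dot_ge0 u : 0 <= dot u u.
Proof. by rewrite dotE sumr_ge0// => i _; rewrite -expr2 sqr_ge0. Qed.

Lemma coord_sqr_le u i : u i 0 ^+ 2 <= dot u u.
Proof.
rewrite dotE (bigD1 i)//= -expr2 lerDl sumr_ge0// => j _.
by rewrite -expr2 sqr_ge0.
Qed.

Lemma dot_eq0 u : (dot u u == 0) = (u == 0).
Proof.
apply/eqP/eqP => [u0|->]; last exact: dot0r.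
apply/colP => i; rewrite mxE; apply/eqP.
by rewrite -sqrf_eq0 eq_le sqr_ge0 andbT -u0 coord_sqr_le.
Qed.

Lemma dot_gt0 u : u != 0 -> 0 < dot u u.
Proof. by move=> u0; rewrite lt_neqAle dot_ge0 eq_sym dot_eq0 u0. Qed.

Definition enorm u : R := Num.sqrt (dot u u).

Lemma enorm_ge0 u : 0 <= enorm u. Proof. exact: sqrtr_ge0. Qed.

Lemma enorm_sqr u : enorm u ^+ 2 = dot u u.
Proof. by rewrite sqr_sqrtr// dot_ge0. Qed.

Lemma enorm_gt0 u : (0 < enorm u) = (u != 0).
Proof. by rewrite sqrtr_gt0 lt_neqAle dot_ge0 andbT eq_sym dot_eq0. Qed.

Lemma enorm0 : enorm 0 = 0. Proof. by rewrite /enorm dot0r sqrtr0. Qed.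

Lemma enorm_eq0 u : (enorm u == 0) = (u == 0).
Proof. by rewrite -sqrf_eq0 enorm_sqr dot_eq0. Qed.

Lemma enormZ a u : enorm (a *: u) = `|a| * enorm u.
Proof.
by rewrite /enorm dotZl dotZr mulrA -expr2 sqrtrM ?sqr_ge0// sqrtr_sqr.
Qed.

Lemma enormN u : enorm (- u) = enorm u.
Proof. by rewrite -scaleN1r enormZ normrN1 mul1r. Qed.

Lemma dot_le_enorm u v : dot u v <= enorm u * enorm v.
Proof.
have [->|u0] := eqVneq u 0; first by rewrite dotC dot0r enorm0 mul0r.
have [->|v0] := eqVneq v 0; first by rewrite dot0r enorm0 mulr0.
have := dot_ge0 (enorm v *: u - enorm u *: v).
rewrite !dot_bilin (dotC v u) -!enorm_sqr.
have : 0 < enorm u by rewrite enorm_gt0.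
have : 0 < enorm v by rewrite enorm_gt0.
move: (enorm u) (enorm v) (dot u v) => a b c b0 a0 H.
have {}H : 0 <= (a * b) * (2 * (a * b - c)) by apply: le_trans H _; lra.
by rewrite pmulr_rge0 ?mulr_gt0// pmulr_rge0// subr_ge0 in H.
Qed.

Lemma dot_ge_enorm u v : - (enorm u * enorm v) <= dot u v.
Proof. by have := dot_le_enorm u (- v); rewrite dotNr enormN lerNl. Qed.

Lemma enormD u v : enorm (u + v) <= enorm u + enorm v.
Proof.
rewrite -(ler_pXn2r (n := 2))// ?nnegrE ?addr_ge0 ?enorm_ge0//.
rewrite enorm_sqr !dot_bilin sqrrD !enorm_sqr (dotC v u).
by have := dot_le_enorm u v; lra.
Qed.

Lemma enormB u v : enorm (u - v) <= enorm u + enorm v.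
Proof. by rewrite -(enormN v) enormD. Qed.

Lemma enorm_le_sqr u a : 0 <= a -> (enorm u <= a) = (dot u u <= a ^+ 2).
Proof. by move=> a0; rewrite -enorm_sqr ler_pXn2r// nnegrE ?enorm_ge0. Qed.

Lemma coord_le_enorm u i : `|u i 0| <= enorm u.
Proof. by rewrite -sqrtr_sqr ler_wsqrtr// coord_sqr_le. Qed.

Lemma enorm_le_coord u a : (forall i, `|u i 0| <= a) -> enorm u <= n%:R * a.
Proof.
have [n0 ua|n0 ua] := posnP n.
  have -> : n%:R = 0 :> R by rewrite n0.
  by rewrite /enorm dotE big1 ?sqrtr0 ?mul0r// => -[i lti]; exfalso; rewrite n0 in lti.
have a0 : 0 <= a by exact: le_trans (ua (Ordinal n0)).
rewrite enorm_le_sqr ?mulr_ge0// dotE.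
apply: (@le_trans _ _ (\sum_(i < n) a ^+ 2)).
  by apply: ler_sum => i _; rewrite -expr2 -real_normK ?num_real// ler_pXn2r ?nnegrE.
rewrite sumr_const card_ord -[leLHS]mulr_natl exprMn ler_wpM2r ?sqr_ge0//.
by rewrite -natrX ler_nat -{1}(expn1 n) leq_pexp2l.
Qed.

End Euclidean.

Section MatrixCompactness.
Variable R : realType.

Lemma mx_cvg (T : Type) (F : set_system T) (FF : Filter F) m n
    (f : T -> 'M[R]_(m, n)) (M : 'M[R]_(m, n)) :
  (forall i j, f x i j @[x --> F] --> M i j) -> f @ F --> M.
Proof.
move=> fc A [P Px PA].
have H := @filter_forall T ('I_m * 'I_n)%type
  (fun ij => [set y | P ij.1 ij.2 (f y ij.1 ij.2)]) F FF
  (fun ij => fc ij.1 ij.2 _ (Px ij.1 ij.2)).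
by apply: filterS H => y Py; apply: PA => i j; apply: (Py (i, j)).
Qed.

Lemma mx_continuous (T : topologicalType) m n (f : T -> 'M[R]_(m, n)) :
  (forall i j, continuous (fun x => f x i j)) -> continuous f.
Proof. by move=> fc x; apply: mx_cvg => i j; exact: fc. Qed.

(** Transported along [vec_mx] from the compactness of boxes of row vectors. *)
Lemma mx_box_compact m n (B : R) :
  compact [set M : 'M[R]_(m, n) | forall i j, `|M i j| <= B].
Proof.
have cB : compact [set v : 'rV[R]_(m * n) | forall i, v ord0 i \in `[(- B), B]].
  apply: (@rV_compact _ _ (fun=> `[(- B), B]%classic)) => _.
  exact: segment_compact.
have vc : continuous (@vec_mx R m n).
  apply: mx_continuous => i j x.
  under eq_fun do rewrite mxE; exact: coord_continuous.
have := continuous_compact (continuous_subspaceT vc) cB.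
congr compact; apply/seteqP; split=> [_ [v /= vB <-] i j|M MB].
  by rewrite mxE ler_norml; have := vB (mxvec_index i j); rewrite in_itv.
exists (mxvec M); last by rewrite mxvecK.
move=> k /=; case/mxvec_indexP: k => i j.
by rewrite mxvecE in_itv/= -ler_norml MB.
Qed.

Lemma mx_bounded_closed_compact m n (B : R) (S : set 'M[R]_(m, n)) :
  closed S -> (forall M, S M -> forall i j, `|M i j| <= B) -> compact S.
Proof. by move=> cS SB; exact: (subclosed_compact cS (@mx_box_compact m n B) SB). Qed.

Lemma mx2_bounded_closed_compact m n p q (B : R)
    (S : set ('M[R]_(m, n) * 'M[R]_(p, q))) :
  closed S ->
  (forall M, S M -> (forall i j, `|M.1 i j| <= B) /\ (forall i j, `|M.2 i j| <= B)) ->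
  compact S.
Proof.
move=> cS SB; have cX := compact_setX (@mx_box_compact m n B) (@mx_box_compact p q B).
by apply: (subclosed_compact cS cX) => M /SB.
Qed.

End MatrixCompactness.

Lemma continuous_min_exists (R : realType) (T : topologicalType) (f : T -> R)
    (A : set T) : A !=set0 -> compact A -> continuous f ->
  exists2 c, A c & forall t, A t -> f c <= f t.
Proof.
move=> A0 cA cf.
have [c /set_mem Ac fc] := compact_EVT_min A0 cA (continuous_subspaceT cf).
by exists c => // t /mem_set; exact: fc.
Qed.

Lemma continuous_max_exists (R : realType) (T : topologicalType) (f : T -> R)
    (A : set T) : A !=set0 -> compact A -> continuous f ->
  exists2 c, A c & forall t, A t -> f t <= f c.
Proof.
move=> A0 cA cf.
have [c /set_mem Ac fc] := compact_EVT_max A0 cA (continuous_subspaceT cf).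
by exists c => // t /mem_set; exact: fc.
Qed.

(** * Continuity of polynomial matrix expressions, and closed conditions *)

Section PolynomialContinuity.
Variables (R : realType) (T : topologicalType).

Lemma continuous_sumr (I : Type) (r : seq I) (P : pred I) (F : I -> T -> R) :
  (forall i, continuous (F i)) -> continuous (fun x => \sum_(i <- r | P i) F i x).
Proof. by move=> cF; apply: continuous_big => // -[a b]; exact: add_continuous. Qed.

Lemma continuous_prodr (I : Type) (r : seq I) (P : pred I) (F : I -> T -> R) :
  (forall i, continuous (F i)) -> continuous (fun x => \prod_(i <- r | P i) F i x).
Proof. by move=> cF; apply: continuous_big => // -[a b]; exact: mul_continuous. Qed.

Lemma continuous_mulr_cst (f : T -> R) (a : R) :
  continuous f -> continuous (fun x => f x * a).
Proof. by move=> cf x; apply: cvgM; [exact: cf|exact: cvg_cst]. Qed.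

(** Stated entrywise, so that products and determinants reduce to sums and products of real
    functions. *)
Definition entry_continuous m n (f : T -> 'M[R]_(m, n)) :=
  forall i j, continuous (fun x => f x i j).

Lemma entry_continuous_cst m n (M : 'M[R]_(m, n)) : entry_continuous (fun=> M).
Proof. by move=> i j x; exact: cvg_cst. Qed.

Lemma entry_continuousM m n p (f : T -> 'M[R]_(m, n)) (g : T -> 'M[R]_(n, p)) :
  entry_continuous f -> entry_continuous g ->
  entry_continuous (fun x => f x *m g x).
Proof.
move=> cf cg i j; under eq_fun do rewrite mxE.
by apply: continuous_sumr => k x; apply: cvgM; [exact: cf|exact: cg].
Qed.

Lemma entry_continuousB m n (f g : T -> 'M[R]_(m, n)) :
  entry_continuous f -> entry_continuous g ->
  entry_continuous (fun x => f x - g x).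
Proof.
move=> cf cg i j; under eq_fun do rewrite !mxE.
by move=> x; apply: cvgB; [exact: cf|exact: cg].
Qed.

Lemma continuous_dot n (f g : T -> 'cV[R]_n) :
  entry_continuous f -> entry_continuous g ->
  continuous (fun x => dot (f x) (g x)).
Proof.
move=> cf cg; under eq_fun do rewrite dotE.
by apply: continuous_sumr => k x; apply: cvgM; [exact: cf|exact: cg].
Qed.

Lemma continuous_det n (f : T -> 'M[R]_n) :
  entry_continuous f -> continuous (fun x => \det (f x)).
Proof.
move=> cf; rewrite /determinant.
apply: continuous_sumr => s x; apply: cvgM; first exact: cvg_cst.
by apply: continuous_prodr => i; exact: cf.
Qed.

Lemma closed_ge_cst (f : T -> R) (a : R) :
  continuous f -> closed [set x | a <= f x].
Proof. by move=> /continuous_closedP cf; exact: (cf _ (@closed_ge R a)). Qed.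

Lemma closed_le_cst (f : T -> R) (a : R) :
  continuous f -> closed [set x | f x <= a].
Proof. by move=> /continuous_closedP cf; exact: (cf _ (@closed_le R a)). Qed.

Lemma closed_eq_cst (f : T -> R) (a : R) :
  continuous f -> closed [set x | f x = a].
Proof. by move=> /continuous_closedP cf; exact: (cf _ (@closed_eq R a)). Qed.

Lemma closed_eq_mx m n (f : T -> 'M[R]_(m, n)) (M : 'M[R]_(m, n)) :
  entry_continuous f -> closed [set x | f x = M].
Proof.
move=> cf; rewrite (_ : mkset _ =
    \bigcap_i \bigcap_j [set x | f x i j = M i j]); last first.
  apply/seteqP; split=> [x /= <- i _ j _//|x /= H].
  by apply/matrixP => i j; exact: H.
by apply: closed_bigI => i _; apply: closed_bigI => j _; exact: closed_eq_cst.
Qed.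

End PolynomialContinuity.

Lemma entry_continuous_id (R : realType) m n :
  entry_continuous (fun M : 'M[R]_(m, n) => M).
Proof. by move=> i j; exact: coord_continuous. Qed.

Lemma entry_continuous_fst (R : realType) m n (U : topologicalType) :
  entry_continuous (fun M : 'M[R]_(m, n) * U => M.1).
Proof.
by move=> i j x; apply: (@continuous_comp _ _ _ fst (fun M : 'M_(m, n) => M i j));
  [exact: cvg_fst|exact: coord_continuous].
Qed.

Lemma entry_continuous_snd (R : realType) m n (U : topologicalType) :
  entry_continuous (fun M : U * 'M[R]_(m, n) => M.2).
Proof.
by move=> i j x; apply: (@continuous_comp _ _ _ snd (fun M : 'M_(m, n) => M i j));
  [exact: cvg_snd|exact: coord_continuous].
Qed.

Section OperatorBounds.
Variables (R : realType) (n : nat).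
Implicit Types (M : 'M[R]_n) (y : 'cV[R]_n) (B : R).

Lemma entry_le_op_bound M B i j :
  (forall y, enorm (M *m y) <= B * enorm y) -> `|M i j| <= B.
Proof.
move=> MB; have := MB (delta_mx j 0); rewrite -colE.
have -> : enorm (delta_mx j 0 : 'cV[R]_n) = 1.
  rewrite /enorm dotE (bigD1 j)//= big1 ?addr0 => [|i' /negPf ij].
    by rewrite !mxE !eqxx mulr1 sqrtr1.
  by rewrite !mxE ij mul0r.
by rewrite mulr1; apply: le_trans; have := coord_le_enorm (col j M) i; rewrite mxE.
Qed.

Lemma op_bound_exists M : exists2 B, 0 < B & forall y, enorm (M *m y) <= B * enorm y.
Proof.
pose S := \sum_i \sum_j `|M i j|.
have S0 : 0 <= S by apply: sumr_ge0 => i _; apply: sumr_ge0.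
exists (n%:R * S + 1); first by rewrite ltr_wpDl ?mulr_ge0.
move=> y; apply: le_trans (_ : n%:R * (S * enorm y) <= _); last first.
  by rewrite mulrDl mul1r -mulrA lerDl enorm_ge0.
apply: enorm_le_coord => i; rewrite mxE (le_trans (ler_norm_sum _ _ _))//.
rewrite [S](bigD1 i)//= mulrDl ler_wpDr ?mulr_ge0 ?enorm_ge0//.
  by apply: sumr_ge0 => k _; apply: sumr_ge0.
rewrite mulr_suml; apply: ler_sum => j _.
by rewrite normrM ler_wpM2l// coord_le_enorm.
Qed.

(** With [z = M^T y], [|z|^2 = <y, M z> <= B |y| |z|]; divide by [|z|]. *)
Lemma op_bound_tr M B : 0 <= B ->
  (forall y, enorm (M *m y) <= B * enorm y) ->
  forall y, enorm (M^T *m y) <= B * enorm y.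
Proof.
move=> B0 MB y; set z := M^T *m y.
have [->|z0] := eqVneq z 0; first by rewrite enorm0 mulr_ge0 ?enorm_ge0.
rewrite -(ler_pM2l (_ : 0 < enorm z)) ?enorm_gt0// -expr2 enorm_sqr.
rewrite {1}/z -dot_mulmxr (le_trans (dot_le_enorm _ _))//.
have := MB z; have := enorm_ge0 y; move: (enorm _) (enorm _) (enorm _) => a b c.
by nra.
Qed.

End OperatorBounds.

(** * Elementary estimates *)

Lemma ln_le_subr1 (R : realType) (x : R) : 0 < x -> ln x <= x - 1.
Proof.
by move=> x0; have := expR_ge1Dx (ln x); rewrite lnK ?posrE//; lra.
Qed.

(** The limit [t -> 0], replaced by one explicit small [t]. *)
Lemma le_of_le_linear_error (R : realType) (a b q : R) :
  (forall t, 0 < t -> t <= 1 -> a <= b + t * q) -> a <= b.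
Proof.
move=> H; rewrite leNgt; apply/negP => ba.
have q0 : 0 < q.
  by have := H 1 ltr01 (lexx _); lra.
pose t := Num.min 1 ((a - b) / (2 * q)).
have t0 : 0 < t by rewrite lt_min ltr01 divr_gt0//; lra.
have := H t t0; rewrite ge_min lexx => /(_ isT).
have : t * q <= (a - b) / 2.
  rewrite -ler_pdivlMr// ge_min; apply/orP; right.
  by rewrite invfM mulrA.
by lra.
Qed.

(** Test on small positive multiples of [b]. This turns bounds with quadratic error into equalities
    of gradients. *)
Lemma linear_le_quadratic (R : realType) (n : nat) (b : 'cV[R]_n) (K r : R) : 0 < r ->
  (forall k, enorm k <= r -> dot b k <= K * dot k k) -> b = 0.
Proof.
move=> r0 H; apply/eqP/negPn/negP => b0.
have eb : 0 < enorm b by rewrite enorm_gt0.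
pose c := r / enorm b; have c0 : 0 < c by exact: divr_gt0.
suff : (1 : R) <= 0 by rewrite ler10.
apply: (@le_of_le_linear_error _ _ _ (K * c)) => t t0 t1.
have := H ((t * c) *: b).
rewrite enormZ (ger0_norm (mulr_ge0 (ltW t0) (ltW c0))).
rewrite -mulrA /c divfK ?gt_eqF// ler_piMl ?(ltW r0)// => /(_ isT).
rewrite -/c !dotZr dotZl => Hb.
have bb := mulr_gt0 (mulr_gt0 t0 c0) (dot_gt0 b0).
rewrite -(ler_pM2r bb) mul1r add0r; apply: le_trans Hb _.
by rewrite le_eqVlt; apply/orP; left; apply/eqP; ring.
Qed.

(* On an interval where the slope of [c] is almost maximal in norm, the slopes of the
   two halves almost agree, by the parallelogram identity. *)
Lemma lipschitz_almost_affine (R : realType) (n : nat) (c : R -> 'cV[R]_n) (T L : R) :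
  0 < T ->
  (forall a b, 0 <= a <= T -> 0 <= b <= T -> enorm (c a - c b) <= L * `|a - b|) ->
  forall eps, 0 < eps -> exists m s, [/\ 0 < s, 0 <= m - s, m + s <= T &
    enorm (c (m + s) + c (m - s) - 2 *: c m) <= eps * s].
Proof.
move=> T0 lip eps eps0.
pose slopes := [set q : R | exists a b, [/\ 0 <= a, a < b, b <= T &
  q * (b - a) ^+ 2 = dot (c b - c a) (c b - c a)]].
have slope_in a b : 0 <= a -> a < b -> b <= T ->
    slopes (dot (c b - c a) (c b - c a) / (b - a) ^+ 2).
  move=> a0 ab bT; exists a, b; split=> //; rewrite divfK//.
  by rewrite expf_neq0// subr_eq0 gt_eqF.
have sup_slopes : has_sup slopes.
  split; first by eexists; exact: (slope_in 0 T).
  exists (L ^+ 2) => q [a [b [a0 ab bT qE]]].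
  have ba0 : 0 < b - a by rewrite subr_gt0.
  rewrite -(ler_pM2r (exprn_gt0 2 ba0)) qE -exprMn.
  have := lip b a; rewrite (gtr0_norm ba0) => H.
  have {}H : enorm (c b - c a) <= L * (b - a) by apply: H; lra.
  by rewrite -enorm_le_sqr// (le_trans (enorm_ge0 _) H).
(* On an interval of length [2 s] the parallelogram identity leaves at most
   [4 del s^2 = (eps s)^2]. *)
pose del := eps ^+ 2 / 4.
have del0 : 0 < del by rewrite divr_gt0// exprn_gt0.
have [q [a [b [a0 ab bT qE]]] qsup] := sup_adherent del0 sup_slopes.
pose s := (b - a) / 2; pose m := (a + b) / 2.
have s0 : 0 < s by rewrite divr_gt0// subr_gt0.
have msa : m - s = a by rewrite /m /s; lra.
have msb : m + s = b by rewrite /m /s; lra.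
have bound x y : 0 <= x -> x < y -> y <= T -> y - x = s ->
    dot (c y - c x) (c y - c x) <= sup slopes * s ^+ 2.
  move=> x0 xy yT yx; rewrite -ler_pdivrMr ?exprn_gt0// -yx.
  by apply: sup_upper_bound => //; exact: slope_in.
exists m, s; split; rewrite ?msa ?msb//.
have H1 : dot (c b - c m) (c b - c m) <= sup slopes * s ^+ 2.
  by apply: bound; lra.
have H2 : dot (c m - c a) (c m - c a) <= sup slopes * s ^+ 2.
  by apply: bound; lra.
have bas : b - a = 2 * s by lra.
rewrite enorm_le_sqr; last by rewrite mulr_ge0// ltW.
rewrite bas in qE.
have H3 : (sup slopes - del) * (2 * s) ^+ 2 <= dot (c b - c a) (c b - c a).
  by rewrite -qE ler_wpM2r ?sqr_ge0// ltW.
have -> : c b + c a - 2 *: c m = (c b - c m) - (c m - c a).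
  by apply/colP => i; rewrite !mxE; ring.
have -> : dot (c b - c m - (c m - c a)) (c b - c m - (c m - c a)) =
   2 * dot (c b - c m) (c b - c m) + 2 * dot (c m - c a) (c m - c a)
   - dot (c b - c a) (c b - c a).
  have -> : c b - c a = (c b - c m) + (c m - c a) by rewrite addrA subrK.
  by move: (c b - c m) (c m - c a) => u v; rewrite !dot_sqrD !dot_bilin; ring.
by move: H1 H2 H3; rewrite /del; lra.
Qed.

Lemma unitmx_tr_inj (F : fieldType) n (M : 'M[F]_n) :
  (forall v : 'cV[F]_n, M^T *m v = 0 -> v = 0) -> M \in unitmx.
Proof.
move=> inj; rewrite -row_free_unit -kermx_eq0; apply/eqP/row_matrixP => i.
rewrite row0; apply: trmx_inj; rewrite trmx0; apply: inj.
by rewrite -trmx_mul -row_mul mulmx_ker row0 trmx0.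
Qed.

(** * Expansion of the matrix exponential *)

Section Exponential.
Variables (R : realType) (n : nat).
Implicit Types (A : 'M[R]_n) (x y : 'cV[R]_n).

Lemma exprmx_op_bound A B : 0 <= B -> (forall y, enorm (A *m y) <= B * enorm y) ->
  forall k y, enorm (A ^+ k *m y) <= B ^+ k * enorm y.
Proof.
move=> B0 AB; elim=> [|k IHk] y.
  by rewrite !expr0 mul1r mul1mx.
rewrite exprS -[A * _]/(A *m _) -mulmxA exprS -mulrA.
by apply: le_trans (AB _) _; rewrite ler_wpM2l.
Qed.

(** Each entry is dominated by the scalar exponential series of an operator bound of [A], so the
    [limn] in [expmx] is a genuine limit. *)
Lemma expmx_cvg A : series (fun k => (k`!%:R : R)^-1 *: A ^+ k) @ \oo --> expmx A.
Proof.
have [B B0 AB] := op_bound_exists A.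
pose u i j : R^nat := fun k => ((k`!%:R : R)^-1 *: A ^+ k) i j.
have uc i j : cvgn (series (u i j)).
  apply: normed_cvg; apply: series_le_cvg (is_cvg_series_exp_coeff B).
  - by move=> k /=.
  - by move=> k; rewrite exp_coeff_ge0// ltW.
  - move=> k; rewrite /u/= mxE normrM ger0_norm ?invr_ge0 ?ler0n// mulrC.
    rewrite /exp_coeff/= ler_wpM2r ?invr_ge0 ?ler0n//.
    exact/entry_le_op_bound/exprmx_op_bound/AB/ltW.
pose L : 'M[R]_n := \matrix_(i, j) limn (series (u i j)).
have cL : series (fun k => (k`!%:R : R)^-1 *: A ^+ k) @ \oo --> L.
  apply: mx_cvg => i j; rewrite mxE.
  have -> : (fun N => series (fun k => (k`!%:R : R)^-1 *: A ^+ k) N i j) = series (u i j).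
    by apply/funext => N; rewrite /series/= summxE.
  exact: uc.
by rewrite /expmx (cvg_lim _ cL).
Qed.

Lemma exprmxZ (t : R) A k : (t *: A) ^+ k = t ^+ k *: A ^+ k :> 'M[R]_n.
Proof.
elim: k => [|k IHk]; first by rewrite !expr0 scale1r.
rewrite !exprS IHk -[_ * _]/((t *: A) *m (t ^+ k *: A ^+ k)).
by rewrite -scalemxAl -scalemxAr scalerA.
Qed.

(** For [t <= 1] the terms of order at least 2 satisfy [t ^+ k <= t ^+ 2], and the remaining factors
    sum to at most [|y| |x| expR B]. *)
Lemma dot_expmx_le A x y : exists2 K, 0 <= K & forall t, 0 < t -> t <= 1 ->
  dot y (expmx (t *: A) *m x) <= dot y x + t * dot y (A *m x) + t ^+ 2 * K.
Proof.
have [B B0 AB] := op_bound_exists A.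
pose K := enorm y * enorm x * expR B.
have K0 : 0 <= K by rewrite !mulr_ge0 ?enorm_ge0 ?expR_ge0.
exists K => // t t0 t1.
pose s N := dot y (series (fun k => (k`!%:R : R)^-1 *: (t *: A) ^+ k) N *m x).
have cs : s @ \oo --> dot y (expmx (t *: A) *m x).
  have cf : continuous (fun M : 'M[R]_n => dot y (M *m x)).
    apply: continuous_dot; first exact: entry_continuous_cst.
    apply: entry_continuousM; last exact: entry_continuous_cst.
    exact: entry_continuous_id.
  exact: (@cvg_comp _ _ _ _ _ _ _ _ (@expmx_cvg (t *: A)) (cf _)).
rewrite -(cvg_lim _ cs)//; apply: limr_le; first by apply/cvg_ex; eexists; exact: cs.
exists 2%N => // N /= N2; rewrite /s /series/= mulmx_suml.
have dot_sum (I : Type) (r : seq I) (f : I -> 'cV[R]_n) :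
    dot y (\sum_(i <- r) f i) = \sum_(i <- r) dot y (f i).
  elim: r => [|i r IHr]; first by rewrite !big_nil dot0r.
  by rewrite !big_cons dotDr IHr.
rewrite dot_sum (@big_cat_nat _ _ _ 2)//= big_nat_recl//= big_nat1.
rewrite !expr0 !expr1 fact0 factS fact0 muln1 invr1 !scale1r mul1mx.
rewrite -scalemxAl dotZr lerD2l.
apply: (@le_trans _ _ (\sum_(2 <= k < N) t ^+ 2 * (enorm y * enorm x) * exp_coeff B k)).
  rewrite big_nat_cond [leRHS]big_nat_cond; apply: ler_sum => k; rewrite andbT.
  move=> /andP[k2 _]; rewrite exprmxZ -!scalemxAl !dotZr.
  have H : dot y (A ^+ k *m x) <= enorm y * enorm x * B ^+ k.
    apply: le_trans (dot_le_enorm _ _) _; rewrite -mulrA ler_wpM2l ?enorm_ge0//.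
    by rewrite mulrC; apply: exprmx_op_bound => //; exact: ltW.
  have tk : t ^+ k <= t ^+ 2 by rewrite ler_wiXn2l// ltW.
  rewrite /exp_coeff/= [leRHS]mulrA mulrC ler_wpM2r ?invr_ge0 ?ler0n//.
  apply: (@le_trans _ _ (t ^+ k * (enorm y * enorm x * B ^+ k))).
    by rewrite ler_wpM2l// exprn_ge0// ltW.
  by rewrite -[leRHS]mulrA ler_wpM2r// !mulr_ge0 ?enorm_ge0// exprn_ge0// ltW.
rewrite -mulr_sumr -mulrA ler_wpM2l ?sqr_ge0// /K ler_wpM2l ?mulr_ge0 ?enorm_ge0//.
apply: (@le_trans _ _ (series (exp_coeff B) N)).
  rewrite /series/= [leRHS](@big_cat_nat _ _ _ 2)//= lerDr sumr_ge0// => k _.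
  by rewrite exp_coeff_ge0// ltW.
apply: nondecreasing_cvgn_le; last exact: is_cvg_series_exp_coeff.
by apply/nondecreasing_series => k _; rewrite exp_coeff_ge0// ltW.
Qed.

End Exponential.

(** * Self-dual cones *)

Section SelfDualCone.
Variables (R : realType) (n : nat) (C : set 'cV[R]_n).
Hypothesis C_dualE : forall y, C y <-> forall x, C x -> 0 <= dot y x.
Implicit Types (u v w x y : 'cV[R]_n) (m g : 'M[R]_n) (r s : R).

Lemma coneZ a x : 0 <= a -> C x -> C (a *: x).
Proof.
move=> a0 /C_dualE Cx; apply/C_dualE => v Cv.
by rewrite dotZl mulr_ge0 ?Cx.
Qed.

Lemma cone0 : C 0.
Proof. by apply/C_dualE => v _; rewrite dotC dot0r. Qed.

Lemma cone_dot_ge0 x y : C x -> C y -> 0 <= dot x y.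
Proof. by move=> /C_dualE Cx /Cx. Qed.

Lemma closed_cone : closed C.
Proof.
rewrite (_ : C = \bigcap_(x in C) [set y | 0 <= dot y x]); last first.
  by apply/seteqP; split=> y; [move/C_dualE|move=> ?; apply/C_dualE].
apply: closed_bigI => x _; apply/closed_ge_cst/continuous_dot.
  exact: entry_continuous_id.
exact: entry_continuous_cst.
Qed.

(** Expand [<x + y, x - y> >= 0]. *)
Lemma cone_normal x y : C (x + y) -> C (x - y) -> enorm y <= enorm x.
Proof.
move=> Cp Cm; have := cone_dot_ge0 Cp Cm; rewrite enorm_le_sqr ?enorm_ge0//.
by rewrite enorm_sqr !dot_bilin (dotC y x); lra.
Qed.

(* By self-duality, [deep r y] says that the Euclidean ball of radius [r] around
   [y] lies in [C]. *)
Definition deep r y := forall v, C v -> r * enorm v <= dot y v.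

Definition icone y := exists2 r, 0 < r & deep r y.

Lemma deep_ball r y h : deep r y -> enorm h <= r -> C (y + h).
Proof.
move=> ry hr; apply/C_dualE => v Cv; rewrite dotDl.
have := ry v Cv; have := dot_ge_enorm h v; have := enorm_ge0 v.
by nra.
Qed.

(** Pair [v] with the point of the ball that lies farthest in the direction [- v]. *)
Lemma ball_deep r y : 0 <= r -> (forall h, enorm h <= r -> C (y + h)) -> deep r y.
Proof.
move=> r0 H v Cv; have [->|v0] := eqVneq v 0; first by rewrite enorm0 mulr0 dot0r.
have ev : 0 < enorm v by rewrite enorm_gt0.
have := cone_dot_ge0 (H (- (r / enorm v) *: v) _) Cv.
rewrite enormZ normrN ger0_norm ?divr_ge0 ?enorm_ge0// divfK ?gt_eqF// lexx.
move=> /(_ isT); rewrite dotDl dotZl -enorm_sqr expr2 mulrA mulNr divfK ?gt_eqF//.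
by lra.
Qed.

Lemma deepW r s y : s <= r -> deep r y -> deep s y.
Proof. by move=> sr ry v Cv; apply: le_trans (ry v Cv); rewrite ler_wpM2r ?enorm_ge0. Qed.

Lemma deep_perturb r s y h : deep r y -> enorm h <= s -> deep (r - s) (y + h).
Proof.
move=> ry hs v Cv; rewrite dotDl.
have := ry v Cv; have := dot_ge_enorm h v; have := enorm_ge0 v.
by nra.
Qed.

Lemma iconeW y : icone y -> C y.
Proof. by move=> [r r0 ry]; rewrite -[y]addr0; apply: (deep_ball ry); rewrite enorm0 ltW. Qed.

Lemma iconeD y x : icone y -> C x -> icone (y + x).
Proof.
move=> [r r0 ry] Cx; exists r => // v Cv; rewrite dotDl.
by have := ry v Cv; have := cone_dot_ge0 Cx Cv; lra.
Qed.

Lemma iconeZ a y : 0 < a -> icone y -> icone (a *: y).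
Proof.
move=> a0 [r r0 ry]; exists (a * r); first exact: mulr_gt0.
by move=> v Cv; rewrite dotZl -mulrA ler_pM2l// ry.
Qed.

Lemma icone_dot_gt0 y v : icone y -> C v -> v != 0 -> 0 < dot y v.
Proof.
move=> [r r0 ry] Cv v0; apply: lt_le_trans (ry v Cv).
by rewrite mulr_gt0// enorm_gt0.
Qed.

Lemma icone_interior y : icone y <-> C° y.
Proof.
split=> [[r r0 ry]|/nbhs_ballP [r /= r0 ryC]].
  (* Topological balls are max-norm balls, and the Euclidean norm is at most [n] times the max norm;
     [n + 1] keeps the denominator positive. *)
  apply/nbhs_ballP; exists (r / (n%:R + 1)) => /=.
    by rewrite divr_gt0// ltr_wpDl.
  move=> z [_ yz]; rewrite -[z](addrNK y) addrC; apply: (deep_ball ry).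
  apply: (@le_trans _ _ (n%:R * (r / (n%:R + 1)))).
    apply: enorm_le_coord => i; have := yz i 0.
    by rewrite /ball/= distrC !mxE => /ltW.
  rewrite mulrCA ger_pMr// ler_pdivrMr ?ltr_wpDl// mul1r; lra.
exists (r / 2); first by rewrite divr_gt0.
apply: ball_deep => [|h hr]; first by rewrite divr_ge0// ltW.
apply: ryC; split=> // i j.
rewrite /ball/= !mxE opprD addNKr normrN (ord1 j).
apply: le_lt_trans (coord_le_enorm h i) _.
by apply: le_lt_trans hr _; lra.
Qed.

(** * Positive maps and automorphisms *)

Definition positive m := forall x, C x -> C (m *m x).

Lemma positiveM m g : positive m -> positive g -> positive (m *m g).
Proof. by move=> mp gp x Cx; rewrite -mulmxA; apply/mp/gp. Qed.

Lemma positive_tr m : positive m -> positive m^T.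
Proof.
move=> mp x Cx; apply/C_dualE => v Cv; rewrite -dot_mulmxr.
by apply: cone_dot_ge0 => //; exact: mp.
Qed.

Lemma positiveZ a m : 0 <= a -> positive m -> positive (a *: m).
Proof. by move=> a0 mp x Cx; rewrite -scalemxAl; apply/coneZ/mp. Qed.

Lemma closed_positive (T : topologicalType) (f : T -> 'M[R]_n) :
  entry_continuous f -> closed [set t | positive (f t)].
Proof.
move=> cf; rewrite (_ : mkset _ =
    \bigcap_(x in C) \bigcap_(v in C) [set t | 0 <= dot (f t *m x) v]).
  apply: closed_bigI => x _; apply: closed_bigI => v _.
  apply/closed_ge_cst/continuous_dot; last exact: entry_continuous_cst.
  by apply: entry_continuousM => //; exact: entry_continuous_cst.
apply/seteqP; split=> t /= H x Cx; first by move=> v Cv; exact/cone_dot_ge0/Cv/H.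
by apply/C_dualE => v; exact: H.
Qed.

(** For [|z| = r] both [u + z] and [u - z] lie in [C], so [cone_normal] on their images bounds [m z]
    by [m u]. A positive map is thus controlled by its value at one interior point. *)
Lemma positive_op_bound m u r y : 0 < r -> deep r u -> positive m ->
  enorm (m *m y) <= enorm (m *m u) / r * enorm y.
Proof.
move=> r0 ru mp; have [->|y0] := eqVneq y 0.
  by rewrite mulmx0 enorm0 mulr0.
have ey : 0 < enorm y by rewrite enorm_gt0.
pose z := (r / enorm y) *: y.
have ez : enorm z = r.
  by rewrite enormZ ger0_norm ?divfK ?gt_eqF// divr_ge0 ?enorm_ge0// ltW.
have := @cone_normal (m *m u) (m *m z).
rewrite -mulmxBr -mulmxDr => /(_ (mp _ _) (mp _ _)).
move=> /(_ (deep_ball ru _)); rewrite ez lexx => /(_ isT).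
move=> /(_ (deep_ball ru _)); rewrite enormN ez lexx => /(_ isT).
rewrite -scalemxAr enormZ ger0_norm ?divr_ge0 ?enorm_ge0 ?(ltW r0)//.
by rewrite mulrAC ler_pdivrMr// mulrAC ler_pdivlMr// [r * _]mulrC.
Qed.

Lemma positive_compact u B : icone u ->
  compact [set m | positive m /\ enorm (m *m u) <= B].
Proof.
move=> [r r0 ru].
have cmu : entry_continuous (fun m : 'M[R]_n => m *m u).
  by apply: entry_continuousM; [exact: entry_continuous_id|exact: entry_continuous_cst].
have [B0|B0] := leP 0 B; last first.
  rewrite (_ : mkset _ = set0); first exact: compact0.
  apply/seteqP; split=> // m [_]; have := enorm_ge0 (m *m u) => /= ? ?.
  by have : 0 <= B by [lra|]; lra.
apply: (@mx_bounded_closed_compact _ _ _ (B / r)).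
  rewrite (_ : mkset _ = [set m | positive m] `&`
      [set m | dot (m *m u) (m *m u) <= B ^+ 2]).
    apply: closedI; first exact/closed_positive/entry_continuous_id.
    by apply/closed_le_cst/continuous_dot.
  by apply/seteqP; split=> m /= [mp]; rewrite enorm_le_sqr.
move=> m [mp mB] i j; apply: entry_le_op_bound => y.
apply: le_trans (positive_op_bound y r0 ru mp) _.
by rewrite ler_wpM2r ?enorm_ge0// ler_pM2r ?invr_gt0.
Qed.

Lemma continuous_norm_det : continuous (fun m : 'M[R]_n => `|\det m|).
Proof.
have cdet : continuous (fun m : 'M[R]_n => \det m).
  exact/continuous_det/entry_continuous_id.
by move=> m; apply: continuous_comp (cdet m) (@norm_continuous _ R _).
Qed.

(* The maximum of |det| on the compact semigroup of positive maps fixing [u]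
   dominates its own square. *)
Lemma positive_fix_det u m : icone u -> positive m -> m *m u = u -> `|\det m| <= 1.
Proof.
move=> iu mp mu.
pose S := [set m | positive m /\ m *m u = u].
have clS : closed S.
  apply: closedI; first exact/closed_positive/entry_continuous_id.
  apply: closed_eq_mx; apply: entry_continuousM; last exact: entry_continuous_cst.
  exact: entry_continuous_id.
have subS : S `<=` [set k | positive k /\ enorm (k *m u) <= enorm u].
  by move=> k [kp ku]; split=> //; rewrite ku.
have cS := subclosed_compact clS (@positive_compact u (enorm u) iu) subS.
have [|k [kp ku] kmax] := continuous_max_exists _ cS continuous_norm_det.
  by exists m.
apply: le_trans (kmax m _) _ => //.
have := kmax (k *m k); rewrite det_mulmx normrM.
have Skk : S (k *m k) by split; [exact: positiveM|rewrite -mulmxA !ku].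
move=> /(_ Skk); have [->//|k0] := eqVneq (`|\det k|) 0.
by rewrite -{3}[`|\det k|]mulr1 ler_pM2l// lt_neqAle eq_sym k0/=.
Qed.

(** For a cone with an interior point this amounts to [Aut_cone]; positivity of both [g] and its
    inverse makes closure under transposition immediate. *)
Definition cone_aut g := [/\ g \in unitmx, positive g & positive (invmx g)].

Lemma cone_autM g m : cone_aut g -> cone_aut m -> cone_aut (g *m m).
Proof.
move=> [gu gp gi] [mu mp mi]; split; first by rewrite unitmx_mul gu.
  exact: positiveM.
have -> : invmx (g *m m) = invmx m *m invmx g; last exact: positiveM.
apply: (can_inj (mulKmx _)) (_ : (g *m m) *m _ = (g *m m) *m _) => [|].
  by rewrite unitmx_mul gu.
by rewrite mulmxV ?unitmx_mul ?gu// mulmxA mulmxK// mulmxV.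
Qed.

Lemma cone_autV g : cone_aut g -> cone_aut (invmx g).
Proof. by move=> [gu gp gi]; split; rewrite ?unitmx_inv// invmxK. Qed.

Lemma cone_aut_tr g : cone_aut g -> cone_aut g^T.
Proof.
by move=> [gu gp gi]; split; rewrite ?unitmx_tr -?trmx_inv//; exact: positive_tr.
Qed.

Lemma cone_autZ a g : 0 < a -> cone_aut g -> cone_aut (a *: g).
Proof.
move=> a0 [gu gp gi]; have au : a \is a GRing.unit by rewrite unitfE gt_eqF.
split; [by rewrite unitmxZ|by apply: positiveZ (ltW a0) gp|].
by rewrite invmxZ ?unitmxZ//; apply: (positiveZ _ gi); rewrite invr_ge0 ltW.
Qed.

Lemma cone_aut1 : cone_aut 1%:M.
Proof. by split; rewrite ?unitmx1 ?invmx1// => x Cx; rewrite mul1mx. Qed.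

(** If [B] bounds the inverse, the image of a ball of radius [r] contains a ball of radius
    [r / B]. *)
Lemma unit_positive_icone m y : m \in unitmx -> positive m -> icone y -> icone (m *m y).
Proof.
move=> mu mp [r r0 ry]; have [B B0 mB] := op_bound_exists (invmx m).
exists (r / B); first exact: divr_gt0.
apply: ball_deep => [|h hr]; first by rewrite divr_ge0 ?ltW.
rewrite -(mulKVmx mu h) -mulmxDr; apply: mp.
apply: (deep_ball ry); apply: le_trans (mB h) _.
by rewrite -(ler_pdivlMl _ _ B0) mulrC.
Qed.

Lemma cone_aut_icone g y : cone_aut g -> icone y -> icone (g *m y).
Proof. by move=> [gu gp _]; exact: unit_positive_icone. Qed.

Definition logdet g : R := ln `|\det g|.

Lemma cone_aut_det g : cone_aut g -> 0 < `|\det g|.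
Proof. by move=> [gu _ _]; rewrite normr_gt0 -unitfE -unitmxE. Qed.

Lemma logdetM g m : cone_aut g -> cone_aut m -> logdet (g *m m) = logdet g + logdet m.
Proof.
by move=> ? ?; rewrite /logdet det_mulmx normrM lnM// posrE cone_aut_det.
Qed.

Lemma logdet1 : logdet 1%:M = 0.
Proof. by rewrite /logdet det1 normr1 ln1. Qed.

Lemma logdetV g : cone_aut g -> logdet (invmx g) = - logdet g.
Proof.
move=> ag; apply/eqP; rewrite -addr_eq0 -logdetM//; last exact: cone_autV.
by case: ag => gu _ _; rewrite mulVmx// logdet1.
Qed.

(** * Cross-positive matrices *)

(** For the nonnegative orthant these are the Metzler matrices. *)
Definition cross_positive A := forall x y, C x -> C y -> dot y x = 0 ->
  0 <= dot y (A *m x).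

Lemma cross_positive_tr A : cross_positive A -> cross_positive A^T.
Proof.
by move=> cA x y Cx Cy yx0; rewrite dot_mulmxr trmxK dotC; apply: cA; rewrite // dotC.
Qed.

Lemma cross_positiveD A A' : cross_positive A -> cross_positive A' ->
  cross_positive (A + A').
Proof.
move=> cA cA' x y Cx Cy yx0.
by rewrite mulmxDl dotDr addr_ge0 ?cA ?cA'.
Qed.

(** The vectors [g^T y] and [g^-1 x] are again in [C] and orthogonal, and
    [<y, g A g^-1 x> = <g^T y, A g^-1 x>]. *)
Lemma cross_positive_conj A g : cone_aut g -> cross_positive A ->
  cross_positive (g *m A *m invmx g).
Proof.
move=> [gu gp gi] cA x y Cx Cy yx0.
rewrite -!mulmxA dot_mulmxr; apply: cA; [exact: gi|exact: positive_tr|].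
by rewrite -dot_mulmxr mulKVmx.
Qed.

(* If [y] were outside [C], then [y + k u] would lie on the boundary of [C] for some
   [k > 0]; cross-positivity at that point contradicts the hypotheses. *)
Lemma cross_positive_monotone A (lam : R) u y : cross_positive A ->
  icone u -> icone (lam *: u - A *m u) -> C (lam *: y - A *m y) -> C y.
Proof.
move=> cA iu iBu CBy; apply: contrapT => Cy.
have [rho rho0 deep_u] := iu.
pose S := [set v | C v] `&` [set v | dot u v = 1].
have cS : compact S.
  apply: (@mx_bounded_closed_compact _ _ _ rho^-1).
    apply: closedI; first exact: closed_cone.
    apply/closed_eq_cst/continuous_dot; first exact: entry_continuous_cst.
    exact: entry_continuous_id.
  move=> v [Cv uv] i j; rewrite (ord1 j); apply: le_trans (coord_le_enorm _ _) _.
  have := deep_u v Cv; rewrite [dot u v]uv => H.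
  by rewrite -(ler_pM2l rho0) divff ?gt_eqF.
have S_scale v : C v -> v != 0 -> S ((dot u v)^-1 *: v).
  move=> Cv v0; have uv0 := icone_dot_gt0 iu Cv v0; split.
    by apply: coneZ => //; rewrite invr_ge0 ltW.
  by rewrite /= dotZr mulVf ?gt_eqF.
have [v1 Cv1 yv1] : exists2 v, C v & dot y v < 0.
  apply: contrapT => /forall2NP H; apply: Cy; apply/C_dualE => v Cv.
  by have [//|/negP] := H v; rewrite -leNgt.
have v10 : v1 != 0 by apply/eqP => v10; rewrite v10 dot0r ltxx in yv1.
have cf : continuous (fun v => dot y v).
  by apply: continuous_dot; [exact: entry_continuous_cst|exact: entry_continuous_id].
have [|v0 [Cv0 uv0] vmin] := continuous_min_exists _ cS cf.
  by exists ((dot u v1)^-1 *: v1); exact: S_scale.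
(* As [v0] minimizes [<y, v>] on the slice [<u, v> = 1], this is the least shift along [u] that
   brings [y] into [C], and [v0] is orthogonal to the shifted point [w]. *)
pose k := - dot y v0.
have k0 : 0 < k.
  rewrite oppr_gt0; apply: le_lt_trans (vmin _ (S_scale v1 Cv1 v10)) _.
  by rewrite dotZr pmulr_rlt0// invr_gt0 icone_dot_gt0.
pose w := y + k *: u.
have Cw : C w.
  apply/C_dualE => v Cv; have [->|vn0] := eqVneq v 0; first by rewrite dot0r.
  have uv := icone_dot_gt0 iu Cv vn0.
  have := vmin _ (S_scale v Cv vn0); rewrite dotZr /w dotDl dotZl /k => H.
  have := ler_wpM2r (ltW uv) H; rewrite mulrAC mulVf ?gt_eqF// mul1r; lra.
have v0w : dot v0 w = 0.
  by rewrite dotC /w dotDl dotZl [dot u v0]uv0 mulr1 subrr.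
have v0n0 : v0 != 0.
  by apply/eqP => E; move: uv0 => /=; rewrite E dot0r => /eqP; rewrite eq_sym oner_eq0.
have := cA w v0 Cw Cv0 v0w.
have H1 := icone_dot_gt0 iBu Cv0 v0n0.
have H2 := cone_dot_ge0 CBy Cv0.
have H3 : dot v0 (lam *: w - A *m w) =
    dot (lam *: y - A *m y) v0 + k * dot (lam *: u - A *m u) v0.
  rewrite -dotZl -dotDl dotC; congr dot.
  by rewrite /w mulmxDr -scalemxAr !scalerDr scalerN !scalerA [k * _]mulrC opprD addrACA.
have := mulr_gt0 k0 H1; move: H3; rewrite dotDr dotNr dotZr v0w mulr0 add0r; lra.
Qed.

(** Both [y] and [- y] are sent to 0 by [lam - A], so monotonicity puts both in [C]. *)
Lemma cross_positive_invertible A (lam : R) u y : cross_positive A ->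
  icone u -> icone (lam *: u - A *m u) -> lam *: y = A *m y -> y = 0.
Proof.
move=> cA iu iBu yE.
have Cy : C y.
  by apply: (cross_positive_monotone cA iu iBu); rewrite yE subrr; exact: cone0.
have CNy : C (- y).
  apply: (cross_positive_monotone cA iu iBu).
  by rewrite scalerN yE mulmxN subrr; exact: cone0.
apply/eqP; rewrite -dot_eq0 eq_le dot_ge0 andbT.
by have := cone_dot_ge0 Cy CNy; rewrite dotNr oppr_ge0.
Qed.

(* The set of [lam >= 0] admitting an interior [u] with [(lam - A) u] interior is an
   up-closed, relatively open subset of [0, +oo[ that contains its infimum. *)
Lemma cross_positive_descent A e : icone e -> cross_positive A ->
  (forall lam, 0 <= lam -> lam%:M - A \in unitmx) ->
  exists2 u, icone u & icone (- (A *m u)).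
Proof.
move=> ie cA Aunit; have [rho rho0 deep_e] := ie.
pose P lam := exists2 u, icone u & icone (lam *: u - A *m u).
have P_up lam lam' : P lam -> lam <= lam' -> P lam'.
  move=> [u iu iBu] ll; exists u => //.
  have -> : lam' *: u - A *m u = lam *: u - A *m u + (lam' - lam) *: u.
    by move: (A *m u) => w; apply/colP => i; rewrite !mxE; ring.
  by apply: iconeD iBu _; apply: coneZ; [rewrite subr_ge0|exact: iconeW].
pose S := [set lam | 0 <= lam /\ P lam].
have S0 : S !=set0.
  (* Large enough for [lam e - A e] to have depth 1. *)
  pose lam := (enorm (A *m e) + 1) / rho.
  exists lam; split; first by rewrite divr_ge0 ?addr_ge0 ?enorm_ge0// ltW.
  exists e => //; exists 1 => //.
  have l0 : 0 <= lam by rewrite divr_ge0 ?addr_ge0 ?enorm_ge0// ltW.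
  have deep_le : deep (lam * rho) (lam *: e).
    by move=> v Cv; rewrite dotZl -mulrA ler_wpM2l// deep_e.
  have := @deep_perturb _ _ _ (- (A *m e)) deep_le (lexx _).
  by apply: deepW; rewrite enormN /lam divfK ?gt_eqF//; lra.
have infS : has_inf S by split=> //; exists 0 => lam [].
pose lam0 := inf S.
have lam00 : 0 <= lam0 by apply: lb_le_inf => // lam [].
have Plam0 : P lam0.
  (* For [lam] in [S] close to [lam0], [(lam - A) x0 = e + (lam - lam0) x0] is still in [C], so
     monotonicity at [lam] puts [x0] in [C]. Adding a small multiple of [e] then gives an interior
     witness at [lam0]. *)
  pose x0 := invmx (lam0%:M - A) *m e.
  have x0E : lam0 *: x0 - A *m x0 = e.
    by rewrite -mul_scalar_mx -mulmxBl mulKVmx// Aunit.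
  have Cx0 : C x0.
    pose del := rho / (enorm x0 + 1).
    have ex1 : 0 < enorm x0 + 1 by rewrite ltr_wpDl ?enorm_ge0.
    have del0 : 0 < del by exact: divr_gt0.
    have [lam [lamge0 Plam] laml] := inf_adherent del0 infS.
    have lam_ge : lam0 <= lam by apply: ge_inf => //; exists 0 => ? [].
    have [u iu iBu] := Plam.
    apply: (cross_positive_monotone cA iu iBu).
    have -> : lam *: x0 - A *m x0 = e + (lam - lam0) *: x0.
      by rewrite -x0E; move: (A *m x0) => w; apply/colP => i; rewrite !mxE; ring.
    apply: (deep_ball deep_e); rewrite enormZ ger0_norm ?subr_ge0//.
    have H : lam - lam0 <= del by rewrite lerBlDl ltW.
    apply: le_trans (ler_wpM2r (enorm_ge0 _) H) _.
    rewrite /del mulrAC ler_pdivrMr// ler_pM2l//; lra.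
  pose b := lam0 *: e - A *m e.
  pose s := rho / 2 / (enorm b + 1).
  have eb1 : 0 < enorm b + 1 by rewrite ltr_wpDl ?enorm_ge0.
  have s0 : 0 < s by rewrite !divr_gt0.
  exists (s *: e + x0); first exact/iconeD/Cx0/iconeZ.
  have -> : lam0 *: (s *: e + x0) - A *m (s *: e + x0) = e + s *: b.
    rewrite -[X in _ = X + _]x0E mulmxDr -scalemxAr /b; move: (A *m e) (A *m x0) => w w'.
    by apply/colP => i; rewrite !mxE; ring.
  exists (rho - rho / 2); first by lra.
  apply: deep_perturb => //; rewrite enormZ ger0_norm ?(ltW s0)//.
  rewrite /s mulrAC ler_pdivrMr// ler_pM2l ?divr_gt0//; lra.
have [lam0_eq0|lam0_neq0] := eqVneq lam0 0.
  by have [u iu] := Plam0; rewrite lam0_eq0 scale0r add0r; exists u.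
have lam0_gt0 : 0 < lam0 by rewrite lt_neqAle eq_sym lam0_neq0.
(* If [lam0 > 0], the same [u] is a witness for [lam0 - del], below the infimum. *)
have [u iu [r r0 deep_Bu]] := Plam0.
pose del := Num.min lam0 (r / 2 / (enorm u + 1)).
have eu1 : 0 < enorm u + 1 by rewrite ltr_wpDl ?enorm_ge0.
have del0 : 0 < del by rewrite lt_min lam0_gt0 !divr_gt0.
have dell : del <= lam0 by rewrite ge_min lexx.
have delr : del * (enorm u + 1) <= r / 2.
  by rewrite -ler_pdivlMr// ge_min lexx orbT.
suff : lam0 <= lam0 - del by lra.
apply: ge_inf; first by exists 0 => ? [].
split; first by rewrite subr_ge0.
exists u => //; exists (r - r / 2); first by lra.
have -> : (lam0 - del) *: u - A *m u = lam0 *: u - A *m u + - (del *: u).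
  by rewrite scalerBl addrAC.
apply: deep_perturb => //; rewrite enormN enormZ ger0_norm ?(ltW del0)//.
by have := enorm_ge0 u; nra.
Qed.

(* A unit vector maximizing the quadratic form is an eigenvector; a nonnegative
   eigenvalue is excluded by [cross_positive_invertible]. *)
Lemma cross_positive_negdef A u : A^T = A -> cross_positive A ->
  icone u -> icone (- (A *m u)) -> forall x, x != 0 -> dot x (A *m x) < 0.
Proof.
move=> symA cA iu iAu x x0; rewrite ltNge; apply/negP => xA.
pose S := [set v : 'cV[R]_n | dot v v = 1].
have cS : compact S.
  apply: (@mx_bounded_closed_compact _ _ _ 1).
    by apply/closed_eq_cst/continuous_dot; exact: entry_continuous_id.
  move=> v vv i j; rewrite (ord1 j); apply: le_trans (coord_le_enorm _ _) _.
  by rewrite enorm_le_sqr// expr1n [dot v v]vv.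
have cf : continuous (fun v : 'cV[R]_n => dot v (A *m v)).
  apply: continuous_dot; first exact: entry_continuous_id.
  by apply: entry_continuousM; [exact: entry_continuous_cst|exact: entry_continuous_id].
have S_scale v : v != 0 -> S ((enorm v)^-1 *: v).
  move=> v0; rewrite /S/= dotZl dotZr mulrA -expr2 exprVn enorm_sqr mulVf//.
  by rewrite dot_eq0.
have [|v Sv vmax] := continuous_max_exists _ cS cf.
  by exists ((enorm x)^-1 *: x); exact: S_scale.
pose lam := dot v (A *m v).
have vmax' y : dot y (A *m y) <= lam * dot y y.
  have [->|y0] := eqVneq y 0; first by rewrite mulmx0 !dot0r mulr0.
  have := vmax _ (S_scale y y0); rewrite -scalemxAr dotZl dotZr mulrA -expr2.
  have yy : 0 < dot y y by exact: dot_gt0.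
  by rewrite exprVn enorm_sqr mulrC ler_pdivrMr.
have lam0 : 0 <= lam.
  have := le_trans xA (vmax' x); rewrite pmulr_lge0//; exact: dot_gt0.
have [B B0 AB] := op_bound_exists A.
have : A *m v - lam *: v = 0.
  (* First-order condition from the competitor [v + k]: [B] bounds [- <k, A k>], and the constant is
     halved because the cross term occurs twice. *)
  apply: (@linear_le_quadratic _ _ _ ((lam + B) / 2) 1) => // k _.
  have := vmax' (v + k); rewrite mulmxDr dot_sqrD !dotDl !dotDr [dot v v]Sv -/lam.
  have -> : dot v (A *m k) = dot k (A *m v) by rewrite dot_mulmxr symA dotC.
  rewrite dotNl dotZl (dotC k (A *m v)).
  have : - dot k (A *m k) <= B * dot k k.
    have := dot_ge_enorm k (A *m k); have := ler_wpM2l (enorm_ge0 k) (AB k).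
    by rewrite mulrCA -expr2 enorm_sqr; lra.
  by lra.
move/eqP; rewrite subr_eq0 => /eqP Av.
have iBu : icone (lam *: u - A *m u).
  by rewrite addrC; apply: iconeD iAu _; exact/coneZ/iconeW.
have v0 := cross_positive_invertible cA iu iBu (esym Av).
by move: Sv; rewrite /S/= v0 dot0r => /eqP; rewrite eq_sym oner_eq0.
Qed.

Lemma cross_positive_lyapunov A x z : cross_positive A ->
  icone x -> icone (- (A *m x)) -> icone z -> icone (- (A^T *m z)) ->
  (exists2 g, cone_aut g & g *m x = (invmx g)^T *m z) ->
  exists P : 'M[R]_n, [/\ P^T = P, cone_aut P,
    forall y, y != 0 -> 0 < dot y (P *m y) &
    forall y, y != 0 -> dot y ((P *m A + A^T *m P) *m y) < 0].
Proof.
move=> cA ix iAx iz iAz [g ag gxz]; have [gu gp gi] := ag.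
exists (g^T *m g); split.
- by rewrite trmx_mul trmxK.
- by apply: cone_autM => //; exact: cone_aut_tr.
- move=> y y0; rewrite -mulmxA dot_mulmxr trmxK dot_gt0//.
  by apply: contra_neq y0 => gy; rewrite -(mulKmx gu y) gy mulmx0.
move=> y y0; pose N := g *m A *m invmx g; pose M := N + N^T.
have cN : cross_positive N by exact: cross_positive_conj.
have cM : cross_positive M by apply: cross_positiveD => //; exact: cross_positive_tr.
have symM : M^T = M by rewrite /M linearD/= trmxK addrC.
have NTE : N^T = (invmx g)^T *m A^T *m g^T by rewrite /N !trmx_mul mulmxA.
(* Only in the summand [N^T (g x)] is [g x] replaced by [g^-T z]; the vector becomes
   [g (- A x) + g^-T (- A^T z)]. *)
have iMu : icone (- (M *m (g *m x))).
  rewrite /M mulmxDl opprD {1}/N -[_ *m invmx g *m _]mulmxA mulKmx//.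
  rewrite {1}gxz NTE -!mulmxA.
  have -> : g^T *m ((invmx g)^T *m z) = z by rewrite trmx_inv mulKVmx// unitmx_tr.
  rewrite -[- (g *m _)]mulmxN -[- ((invmx g)^T *m _)]mulmxN; apply: iconeD.
    exact: cone_aut_icone.
  by apply/iconeW/cone_aut_icone => //; exact/cone_aut_tr/cone_autV.
have gy0 : g *m y != 0.
  by apply: contra_neq y0 => gy; rewrite -(mulKmx gu y) gy mulmx0.
have := cross_positive_negdef symM cM (cone_aut_icone ag ix) iMu gy0.
congr (_ < 0); rewrite dot_mulmxl; congr dot; rewrite !mulmxA; congr (_ *m _).
rewrite /M mulmxDr mulmxDl NTE /N !mulmxA mulmxKV// trmx_inv.
by rewrite mulmxV ?unitmx_tr// mul1mx.
Qed.

(** * Scaling points of homogeneous self-dual cones *)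

Hypothesis C_homog : forall x y, icone x -> icone y ->
  exists2 g, cone_aut g & g *m x = y.

(* A maximizer of |det| among all positive maps need not be an automorphism a priori,
   but composing with the inverse of an automorphism that agrees with it at [u] shows
   that this automorphism is a maximizer as well. *)
Lemma aut_max_det u (phi : 'cV[R]_n -> R) B : icone u -> continuous phi ->
  (forall y, C y -> phi y <= 1 -> enorm y <= B) ->
  (exists2 g, cone_aut g & phi (g *m u) <= 1) ->
  exists2 g, cone_aut g /\ phi (g *m u) <= 1 &
    forall h, cone_aut h -> phi (h *m u) <= 1 -> `|\det h| <= `|\det g|.
Proof.
move=> iu cphi phiB [g0 ag0 phig0].
pose S := [set m | positive m /\ phi (m *m u) <= 1].
have clS : closed S.
  apply: closedI; first exact/closed_positive/entry_continuous_id.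
  apply: closed_le_cst => m; apply: continuous_comp; last exact: cphi.
  apply: mx_continuous; apply: entry_continuousM; last exact: entry_continuous_cst.
  exact: entry_continuous_id.
have subS : S `<=` [set k | positive k /\ enorm (k *m u) <= B].
  by move=> k [kp ku]; split=> //; apply: phiB => //; apply/kp/iconeW.
have cS := subclosed_compact clS (@positive_compact u B iu) subS.
have S_aut g : cone_aut g -> phi (g *m u) <= 1 -> S g by move=> [].
have [|k [kp ku] kmax] := continuous_max_exists _ cS continuous_norm_det.
  by exists g0; exact: S_aut.
have kunit : k \in unitmx.
  rewrite unitmxE unitfE -normr_gt0; apply: lt_le_trans (kmax g0 _).
    exact: cone_aut_det.
  exact: S_aut.
have [g ag gu] := C_homog iu (unit_positive_icone kunit kp iu).
exists g; first by rewrite gu.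
move=> h ah hu; apply: le_trans (kmax _ (S_aut _ ah hu)) _.
have gunit : g \in unitmx by case: ag.
have := @positive_fix_det u (invmx g *m k) iu.
rewrite -mulmxA -gu mulKmx// => /(_ (positiveM _ kp) erefl).
have [_ _ agi] := ag => /(_ agi).
rewrite det_mulmx normrM det_inv normrV -?unitmxE//.
by rewrite mulrC ler_pdivrMr ?mul1r ?cone_aut_det.
Qed.

Hypothesis n_gt0 : (0 < n)%N.

Let n0 : 0 < n%:R :> R. Proof. by rewrite ltr0n. Qed.

Lemma icone_neq0 y : icone y -> y != 0.
Proof.
have [x x0] : exists x : 'cV[R]_n, x != 0.
  exists (delta_mx (Ordinal n_gt0) 0); apply/eqP => /colP /(_ (Ordinal n_gt0)).
  by rewrite !mxE !eqxx => /eqP; rewrite oner_eq0.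
move=> [s s0 sy]; apply/eqP => y0.
have := @deep_ball _ _ ((s / enorm x) *: x) sy.
have := @deep_ball _ _ (- ((s / enorm x) *: x)) sy.
have ex : 0 < enorm x by rewrite enorm_gt0.
rewrite enormN enormZ ger0_norm ?divr_ge0 ?enorm_ge0 ?(ltW s0)// divfK ?gt_eqF//.
rewrite lexx y0 !add0r => /(_ isT) Cm /(_ isT) Cp.
have := cone_dot_ge0 Cm Cp.
rewrite dotNl dotZl dotZr mulrA => H.
have : 0 < s / enorm x * (s / enorm x) * dot x x.
  by rewrite !mulr_gt0 ?invr_gt0 ?dot_gt0.
by lra.
Qed.

(** Take [x = g v] with [|det g|] maximal under [<g v, v> <= n]. With [d = <h x, v>], rescaling
    [h g] by [n / d] meets the constraint, so [logdet h <= n ln (d / n) <= d - n], and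
    [<x, v> <= n]. *)
Lemma support_point_exists v : icone v ->
  exists2 x, icone x &
    forall h, cone_aut h -> logdet h <= dot (h *m x) v - dot x v.
Proof.
move=> iv.
have [r r0 rv] := iv.
have vv : 0 < dot v v by rewrite dot_gt0// icone_neq0.
have [|||g [ag gv] gmax] := @aut_max_det v (fun y => dot y v / n%:R) (n%:R / r) iv.
- by apply/continuous_mulr_cst/continuous_dot;
    [exact: entry_continuous_id|exact: entry_continuous_cst].
- move=> y Cy; rewrite ler_pdivrMr// mul1r ler_pdivlMr// mulrC; apply: le_trans.
  by rewrite dotC; exact: rv.
- exists ((n%:R / dot v v) *: 1%:M).
    by apply: cone_autZ; [rewrite divr_gt0|exact: cone_aut1].
  by rewrite -scalemxAl mul1mx dotZl divfK ?gt_eqF// divff ?gt_eqF.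
exists (g *m v); first exact: cone_aut_icone.
move=> h ah; set x := g *m v.
have ihx : icone (h *m x) by do 2 apply: cone_aut_icone => //.
pose d := dot (h *m x) v.
have d0 : 0 < d by rewrite /d dotC icone_dot_gt0 ?icone_neq0//; exact: iconeW.
have c0 : 0 < n%:R / d by rewrite divr_gt0.
have := gmax ((n%:R / d) *: (h *m g)) (cone_autZ c0 (cone_autM ah ag)).
rewrite -scalemxAl dotZl -mulmxA -/x -/d divfK ?gt_eqF// divff ?gt_eqF// lexx.
move=> /(_ isT); rewrite detZ det_mulmx !normrM mulrA ger_pMl ?cone_aut_det//.
rewrite (ger0_norm (exprn_ge0 _ (ltW c0))) => Hdet.
have : ln ((n%:R / d) ^+ n * `|\det h|) <= 0.
  by rewrite ln_le0.
rewrite lnM ?posrE ?exprn_gt0 ?cone_aut_det// lnXn//.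
rewrite -[n%:R / d]invf_div lnV ?posrE ?divr_gt0//.
have := ln_le_subr1 (divr_gt0 d0 n0).
rewrite -(ler_pM2l n0) mulrBr mulrCA divff ?gt_eqF// !mulr1 => H1.
rewrite -[X in X + _ <= 0]mulr_natl mulrN -/(logdet h).
move: gv; rewrite ler_pdivrMr// mul1r -/x.
by rewrite -/d; lra.
Qed.

(** As for [support_point_exists], now under [|g u|^2 <= n]; the rescaling factor is a square root,
    whence the division by 2. Here the normal will be the point itself. *)
Lemma min_norm_point_exists u : icone u ->
  exists2 e, icone e & forall h, cone_aut h ->
    logdet h <= (dot (h *m e) (h *m e) - dot e e) / 2.
Proof.
move=> iu; have uu : 0 < dot u u by rewrite dot_gt0// icone_neq0.
have [|||g [ag gu] gmax] :=
    @aut_max_det u (fun y => dot y y / n%:R) (Num.sqrt n%:R) iu.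
- by apply/continuous_mulr_cst/continuous_dot; exact: entry_continuous_id.
- move=> y Cy; rewrite ler_pdivrMr// mul1r => ?.
  by rewrite enorm_le_sqr ?sqrtr_ge0// sqr_sqrtr// ltW.
- exists ((Num.sqrt n%:R / enorm u) *: 1%:M).
    apply: cone_autZ; last exact: cone_aut1.
    by rewrite divr_gt0 ?sqrtr_gt0// enorm_gt0 icone_neq0.
  rewrite -scalemxAl mul1mx dotZl dotZr mulrA -expr2 expr_div_n sqr_sqrtr ?(ltW n0)//.
  by rewrite enorm_sqr divfK ?gt_eqF// divff ?gt_eqF.
exists (g *m u); first exact: cone_aut_icone.
move=> h ah; set e := g *m u.
have ihe : icone (h *m e) by do 2 apply: cone_aut_icone => //.
pose d := dot (h *m e) (h *m e).
have d0 : 0 < d by rewrite dot_gt0// icone_neq0.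
have c0 : 0 < n%:R / d by rewrite divr_gt0.
pose c := Num.sqrt (n%:R / d).
have cp : 0 < c by rewrite sqrtr_gt0.
have := gmax (c *: (h *m g)) (cone_autZ cp (cone_autM ah ag)).
rewrite -scalemxAl dotZl dotZr mulrA -expr2 sqr_sqrtr ?(ltW c0)//.
rewrite -mulmxA -/e -/d divfK ?gt_eqF// divff ?gt_eqF// lexx.
move=> /(_ isT); rewrite detZ det_mulmx !normrM mulrA ger_pMl ?cone_aut_det//.
rewrite (ger0_norm (exprn_ge0 _ (ltW cp))) => Hdet.
have : ln ((c ^+ n * `|\det h|) ^+ 2) <= 0.
  by rewrite ln_le0// expr_le1// mulr_ge0// exprn_ge0// ltW.
rewrite lnXn ?mulr_gt0 ?exprn_gt0 ?cone_aut_det// lnM ?posrE ?exprn_gt0 ?cone_aut_det//.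
rewrite -/(logdet h) mulrnDl -lnXn ?exprn_gt0// exprAC sqr_sqrtr ?(ltW c0)//.
rewrite lnXn// -[n%:R / d]invf_div lnV ?posrE ?divr_gt0//.
have := ln_le_subr1 (divr_gt0 d0 n0).
rewrite -(ler_pM2l n0) mulrBr mulrCA divff ?gt_eqF// !mulr1 => H1.
rewrite -[X in X + _ <= 0]mulr_natl mulrN -[X in _ + X <= 0]mulr_natl.
move: gu; rewrite ler_pdivrMr// mul1r -/e -/d.
by lra.
Qed.

(** Concavity on the segment from [e] to [h e] gives [t * logdet h <= logdet a0], where
    [a0 e = e + t k]. The quadratic bound at [a0], divided by [t], becomes the linear one as
    [t -> 0]. *)
Lemma base_point_exists u : icone u ->
  exists2 e, icone e & forall h, cone_aut h -> logdet h <= dot (h *m e) e - dot e e.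
Proof.
move=> iu; have [e ie emin] := min_norm_point_exists iu; exists e => // h ah.
pose k := h *m e - e.
have ih : icone (h *m e) by exact: cone_aut_icone.
apply: (@le_of_le_linear_error _ _ _ (dot k k / 2)) => t t0 t1.
pose w := e + t *: k.
have iw : icone w.
  rewrite /w /k scalerBr addrCA -{2}[e]scale1r -scalerBl; apply: iconeD.
    exact: iconeZ.
  by apply: coneZ; [rewrite subr_ge0|exact: iconeW].
have [a0 aa0 a0e] := C_homog ie iw.
have [x ix xsupp] := support_point_exists ie.
have [a aa ax] := C_homog ix iw.
have aunit : a \in unitmx by case: aa.
have a0unit : a0 \in unitmx by case: aa0.
(* The support inequality at [x] carried to [w] by [a]. Its instances for [h] and for the identity,
   weighted by [t] and [1 - t], cancel the slope [s]. *)
have supp c : cone_aut c ->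
    logdet c - logdet a0 <= dot (invmx a *m (c *m e - w)) e.
  move=> ac; have := xsupp (invmx a *m c *m invmx a0 *m a).
  rewrite !logdetM ?logdetV//; try by repeat apply: cone_autM => //; apply: cone_autV.
  have -> : invmx a *m c *m invmx a0 *m a *m x = invmx a *m (c *m e).
    by rewrite -!mulmxA ax -a0e mulKmx.
  have <- : invmx a *m w = x by rewrite -ax mulKmx.
  rewrite -dotNl -dotDl -mulmxN -mulmxDr.
  have H : cone_aut (invmx a *m c *m invmx a0 *m a).
    by repeat apply: cone_autM => //; apply: cone_autV.
  by move=> /(_ H); lra.
have := supp _ cone_aut1; have := supp _ ah.
have -> : h *m e - w = (1 - t) *: k.
  by rewrite /w scalerBl scale1r opprD addrA.
have -> : 1%:M *m e - w = - t *: k by rewrite mul1mx /w opprD addrA subrr add0r scaleNr.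
rewrite -!scalemxAr !dotZl logdet1; move: (dot (invmx a *m k) e) => s.
have := emin _ aa0; rewrite a0e.
have -> : dot w w = dot e e + t * (2 * dot k e) + t * t * dot k k.
  by rewrite dot_sqrD dotZl !dotZr (dotC e k); ring.
have -> : dot (h *m e) e - dot e e = dot k e by rewrite /k dotDl dotNl.
move: (dot k e) (dot k k) (dot e e) (logdet h) (logdet a0) => p q E lh la H0 H1 H2.
have H3 : t * lh <= la.
  have := ler_wpM2l (ltW t0) H1.
  have : (1 - t) * (0 - la) <= (1 - t) * (- t * s) by rewrite ler_wpM2l// subr_ge0.
  by lra.
have {H3} : t * lh <= t * (p + t * (q / 2)) by lra.
by rewrite ler_pM2l.
Qed.


Lemma dot_contragredient g u v : g \in unitmx ->
  dot (g *m u) ((invmx g)^T *m v) = dot u v.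
Proof. by move=> gu; rewrite -dot_mulmxl mulKmx. Qed.

(* Recording an automorphism together with its inverse makes invertibility a closed
   condition. *)
Definition aut_pairs B : set ('M[R]_n * 'M[R]_n) :=
  [set p | [/\ positive p.1, positive p.2, p.1 *m p.2 = 1%:M &
     (forall i j, `|p.1 i j| <= B) /\ (forall i j, `|p.2 i j| <= B)]].

Lemma aut_pairs_compact B : compact (aut_pairs B).
Proof.
apply: (@mx2_bounded_closed_compact _ _ _ _ _ B); last by move=> p [].
have c1 := @entry_continuous_fst R n n 'M[R]_n.
have c2 := @entry_continuous_snd R n n 'M[R]_n.
rewrite (_ : aut_pairs B = [set p : 'M[R]_n * 'M[R]_n | positive p.1] `&`
   [set p : 'M[R]_n * 'M[R]_n | positive p.2] `&`
   [set p : 'M[R]_n * 'M[R]_n | p.1 *m p.2 = 1%:M] `&`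
   ((\bigcap_i \bigcap_j [set p : 'M[R]_n * 'M[R]_n | `|p.1 i j| <= B]) `&`
    (\bigcap_i \bigcap_j [set p : 'M[R]_n * 'M[R]_n | `|p.2 i j| <= B]))); last first.
  apply/seteqP; split=> p.
    move=> [pp1 pp2 pp12 [H1 H2]]; split; first by split; first split.
    by split=> i _ j _; [exact: H1|exact: H2].
  move=> [[[pp1 pp2] pp12] [H1 H2]]; split=> //.
  by split=> i j; [exact: H1|exact: H2].
apply: closedI; first apply: closedI; first apply: closedI.
- exact: closed_positive.
- exact: closed_positive.
- by apply: closed_eq_mx; exact: entry_continuousM.
- apply: closedI; apply: closed_bigI => i _; apply: closed_bigI => j _.
    apply: closed_le_cst => p.
    by apply: continuous_comp (c1 i j p) (@norm_continuous _ R _).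
  apply: closed_le_cst => p.
  by apply: continuous_comp (c2 i j p) (@norm_continuous _ R _).
Qed.

Lemma aut_pairsP B p : aut_pairs B p -> cone_aut p.1 /\ invmx p.1 = p.2.
Proof.
move=> [p1 p2 p12 _]; have [u1 _] := mulmx1_unit p12.
have -> : invmx p.1 = p.2 by rewrite -[LHS]mulmx1 -p12 mulKmx.
split=> //; split=> //.
by have -> : invmx p.1 = p.2 by rewrite -[LHS]mulmx1 -p12 mulKmx.
Qed.

Lemma aut_pairs_mem B g : cone_aut g ->
  (forall y, enorm (g *m y) <= B * enorm y) ->
  (forall y, enorm (invmx g *m y) <= B * enorm y) -> aut_pairs B (g, invmx g).
Proof.
move=> [gu gp gi] gB iB; split=> //=; first by rewrite mulmxV.
by split=> i j; apply: entry_le_op_bound.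
Qed.

(** * The contragredient involution at a base point *)

Section BasePoint.
Variable e : 'cV[R]_n.
Hypothesis e_icone : icone e.
Hypothesis e_supp : forall h, cone_aut h -> logdet h <= dot (h *m e) e - dot e e.

(* [chart], [logvol] and [star] are meaningful only on the interior of [C]; elsewhere
   [chart] is the junk value 1. *)
Definition chart w : 'M[R]_n := xget 1%:M [set g | cone_aut g /\ g *m e = w].

Definition logvol w : R := logdet (chart w).

Definition star w : 'cV[R]_n := (invmx (chart w))^T *m e.

Lemma chartP w : icone w -> cone_aut (chart w) /\ chart w *m e = w.
Proof.
move=> iw; have [g ag ge] := C_homog e_icone iw.
by apply: (@xgetPex _ 1%:M [set g | cone_aut g /\ g *m e = w]); exists g.
Qed.

(** Both [g^-1 h] and [h^-1 g] fix [e], so the support inequality bounds both log-determinants by 0.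
    Hence [logvol] does not depend on the choice of [chart]. *)
Lemma logdet_eq g h : cone_aut g -> cone_aut h -> g *m e = h *m e ->
  logdet g = logdet h.
Proof.
move=> ag ah gh; have [gu _ _] := ag; have [hu _ _] := ah.
have := e_supp (cone_autM (cone_autV ag) ah).
have := e_supp (cone_autM (cone_autV ah) ag).
rewrite -!mulmxA gh mulKmx// -gh mulKmx// !logdetM ?logdetV//; try exact: cone_autV.
by lra.
Qed.

Lemma logvolE g : cone_aut g -> logvol (g *m e) = logdet g.
Proof.
move=> ag; have [ac ce] := chartP (cone_aut_icone ag e_icone).
exact: logdet_eq.
Qed.

Lemma logvolM g w : cone_aut g -> icone w ->
  logvol (g *m w) = logdet g + logvol w.
Proof.
move=> ag iw; have [ac ce] := chartP iw.
by rewrite -{1}ce mulmxA logvolE ?logdetM//; exact: cone_autM.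
Qed.

(** The support inequality for [g^-1 chart w]: it makes [g^-T e] a supergradient of [logvol] at
    [g e]. *)
Lemma logvol_le g w : cone_aut g -> icone w ->
  logvol w <= logdet g + dot (w - g *m e) ((invmx g)^T *m e).
Proof.
move=> ag iw; have [ac ce] := chartP iw; have [gu _ _] := ag.
have := e_supp (cone_autM (cone_autV ag) ac).
rewrite logdetM ?logdetV//; last exact: cone_autV.
rewrite -mulmxA ce dotDl dotNl dot_contragredient// [dot w _]dot_mulmxr trmxK /logvol.
by lra.
Qed.

Lemma logvol_le_base w : icone w -> logvol w <= dot (w - e) e.
Proof.
move=> iw; have := logvol_le cone_aut1 iw.
by rewrite logdet1 add0r invmx1 trmx1 !mul1mx.
Qed.

(** The pairing of [g e] with [g^-T e] equals [<e, e>]. *)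
Lemma contragredient_bound g r : cone_aut g -> deep r (g *m e) ->
  r * enorm ((invmx g)^T *m e) <= dot e e.
Proof.
move=> ag rge; have [gu _ gi] := ag; rewrite -(dot_contragredient _ _ gu).
by apply: rge; apply: (positive_tr gi); exact: iconeW.
Qed.

(** Apply [positive_op_bound] to [g^-T] at [e], then transpose. *)
Lemma invmx_op_bound g r y : 0 < r -> deep r e -> cone_aut g ->
  enorm (invmx g *m y) <= enorm ((invmx g)^T *m e) / r * enorm y.
Proof.
move=> r0 re [gu gp gi]; rewrite -{1}[invmx g]trmxK.
apply: op_bound_tr => [|{}y]; first by rewrite divr_ge0 ?enorm_ge0// ltW.
by apply: positive_op_bound => //; exact: positive_tr.
Qed.

(** Automorphisms moving [e] only slightly stay in a compact set: [g e] controls [g], and [g^-T e]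
    controls the inverse. The constant [B] adds the two bounds. *)
Lemma aut_pairs_near : exists r B, [/\ 0 < r,
  forall w, enorm (w - e) <= r -> deep r w &
  forall g, cone_aut g -> enorm (g *m e - e) <= r -> aut_pairs B (g, invmx g)].
Proof.
have [rho rho0 deep_rho] := e_icone.
pose r := rho / 2; have r0 : 0 < r by rewrite divr_gt0.
have near_deep w : enorm (w - e) <= r -> deep r w.
  move=> wr; have := deep_perturb deep_rho wr; rewrite subrKC.
  by apply: deepW; rewrite /r; lra.
exists r, ((enorm e + r + dot e e / r) / rho); split=> // g ag ger.
have ge : enorm (g *m e) <= enorm e + r.
  by rewrite -[g *m e](subrKC e); apply: le_trans (enormD _ _) _; rewrite lerD2l.
have Er : enorm ((invmx g)^T *m e) <= dot e e / r.
  by rewrite ler_pdivlMr// mulrC; apply: contragredient_bound => //; exact: near_deep.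
have Er0 : 0 <= dot e e / r by rewrite divr_ge0 ?dot_ge0 ?(ltW r0).
have ee := enorm_ge0 e.
have [gu gp gi] := ag.
apply: aut_pairs_mem => // y.
  apply: le_trans (positive_op_bound y rho0 deep_rho gp) _.
  by rewrite ler_wpM2r ?enorm_ge0// ler_pM2r ?invr_gt0//; lra.
apply: le_trans (invmx_op_bound y rho0 deep_rho ag) _.
by rewrite ler_wpM2r ?enorm_ge0// ler_pM2r ?invr_gt0//; lra.
Qed.

(* A minimizer [a e] of [logvol w + K0 |w - e|^2] over a small ball is a point where
   [logvol] is touched from below by a paraboloid; [a^-1] carries it to [e]. *)
Lemma logvol_ge_base : exists r K, [/\ 0 < r, 0 < K & forall k, enorm k <= r ->
  icone (e + k) /\ dot e k - K * dot k k <= logvol (e + k)].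
Proof.
have [r [B [r0 near_deep pairsP]]] := aut_pairs_near.
pose E := dot e e; have E0 : 0 <= E by exact: dot_ge0.
(* Chosen to force the minimizer into the ball of radius [r / 2], away from the boundary of the
   constraint. *)
pose K0 := 2 * (E + 1) / r ^+ 2.
have K00 : 0 < K0.
  apply: divr_gt0; last exact: exprn_gt0.
  by apply: mulr_gt0 => //; rewrite ltr_wpDl.
have near_icone w : enorm (w - e) <= r -> icone w.
  by move=> wr; exists r => //; exact: near_deep.
pose S := aut_pairs B `&` [set p : 'M[R]_n * 'M[R]_n | dot (p.1 *m e - e) (p.1 *m e - e) <= r ^+ 2].
have SP g : cone_aut g -> enorm (g *m e - e) <= r -> S (g, invmx g).
  move=> ag ger; split; last by rewrite /= -enorm_le_sqr// ltW.
  exact: pairsP.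
have c1 := @entry_continuous_fst R n n 'M[R]_n.
have cdist : continuous
    (fun p : 'M[R]_n * 'M[R]_n => dot (p.1 *m e - e) (p.1 *m e - e)).
  by apply: continuous_dot; apply: entry_continuousB;
    try apply: entry_continuousM; try exact: entry_continuous_cst.
have clS : compact S.
  by apply: compact_closedI; [exact: aut_pairs_compact|exact: closed_le_cst].
(* The exponential of the penalized [logvol], which is visibly continuous in the pair. *)
pose psi (p : 'M[R]_n * 'M[R]_n) : R := `|\det p.1| *
  expR (dot (p.1 *m e - e) (p.1 *m e - e) * K0).
have cpsi : continuous psi.
  have cdet := continuous_det c1.
  have cnd : continuous (fun p : 'M[R]_n * 'M[R]_n => `|\det p.1|).
    by move=> p; apply: continuous_comp (cdet p) (@norm_continuous _ R _).
  have cex : continuous (fun p : 'M[R]_n * 'M[R]_n =>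
      expR (dot (p.1 *m e - e) (p.1 *m e - e) * K0)).
    have c3 := @continuous_mulr_cst _ _ _ K0 cdist.
    by move=> p; apply: continuous_comp (c3 p) (@continuous_expR R _).
  by move=> p; apply: cvgM; [exact: cnd|exact: cex].
have S1 : S (1%:M, 1%:M).
  have := SP _ cone_aut1; rewrite mul1mx subrr enorm0 invmx1; apply; exact: ltW.
have [|[a a'] Sa amin] := continuous_min_exists _ clS cpsi; first by exists (1%:M, 1%:M).
have [/= aa _] := aut_pairsP (proj1 Sa).
have {}amin w : icone w -> enorm (w - e) <= r ->
    logdet a + dot (a *m e - e) (a *m e - e) * K0 <= logvol w + dot (w - e) (w - e) * K0.
  move=> iw wr; have [ac ce] := chartP iw.
  have := amin (chart w, invmx (chart w)); rewrite -{1}ce in wr.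
  move=> /(_ (SP _ ac wr)); rewrite /psi/= ce.
  rewrite -ler_ln ?posrE ?mulr_gt0 ?expR_gt0 ?cone_aut_det//.
  by rewrite !lnM ?posrE ?expR_gt0 ?cone_aut_det// !expRK.
set D := enorm (a *m e - e).
(* Comparison with [e] gives [logdet a + D^2 K0 <= 0], while the supergradient at [a e] gives
   [0 <= logdet a + D E / r]. *)
have Dr : D <= r / 2.
  have Er : enorm ((invmx a)^T *m e) <= E / r.
    rewrite ler_pdivlMr// mulrC; apply: contragredient_bound => //; apply: near_deep.
    by have [_ /=] := Sa; rewrite -enorm_le_sqr// ltW.
  have := amin e e_icone; rewrite subrr enorm0 dot0r mul0r addr0 => /(_ (ltW r0)).
  have -> : logvol e = 0 by rewrite -{1}[e]mul1mx logvolE ?logdet1//; exact: cone_aut1.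
  have := logvol_le aa e_icone.
  have -> : logvol e = 0 by rewrite -{1}[e]mul1mx logvolE ?logdet1//; exact: cone_aut1.
  rewrite -enorm_sqr -/D.
  have := dot_le_enorm (e - a *m e) ((invmx a)^T *m e).
  rewrite -[e - _]opprB enormN -/D.
  have D0 : 0 <= D by exact: enorm_ge0.
  have := ler_wpM2l D0 Er.
  move: (dot _ _) (enorm (_ *m _)) (logdet a) => s s' la H1 H2 H3 H4.
  have H5 : D * (D * K0) <= D * (E / r) by rewrite mulrA -expr2; lra.
  have [->|Dn] := eqVneq D 0; first by rewrite divr_ge0// ltW.
  have Dp : 0 < D by rewrite lt_neqAle eq_sym Dn.
  rewrite ler_pM2l// /K0 in H5.
  rewrite ler_pdivlMr// mulrC in H5.
  have : r * (D * (2 * (E + 1) / r ^+ 2)) = 2 * D * (E + 1) / r.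
    by field; rewrite gt_eqF.
  move=> H6; rewrite {}H6 ler_pdivrMr// in H5.
  by rewrite ler_pdivlMr//; nra.
have [al al0 aal] := op_bound_exists a.
pose q := (- (2 * K0)) *: (a^T *m (a *m e - e)).
pose K := K0 * al ^+ 2; pose r1 := r / (2 * al).
have r10 : 0 < r1 by rewrite divr_gt0// mulr_gt0.
have lower k : enorm k <= r1 ->
    icone (e + k) /\ dot q k - K * dot k k <= logvol (e + k).
  move=> kr; pose w := a *m (e + k).
  have akr : enorm (a *m k) <= r / 2.
    apply: le_trans (aal k) _; move: kr; rewrite /r1 ler_pdivlMr ?mulr_gt0//; lra.
  have wE : w - e = (a *m e - e) + a *m k by rewrite /w mulmxDr addrAC.
  have wr : enorm (w - e) <= r.
    by rewrite wE; apply: le_trans (enormD _ _) _; rewrite -/D; lra.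
  have iw := near_icone _ wr.
  have iek : icone (e + k).
    have [au _ _] := aa; rewrite -[e + k](mulKmx au); apply: cone_aut_icone => //.
    exact: cone_autV.
  split=> //; have := amin w iw wr; rewrite logvolM// wE.
  set b := a *m e - e; rewrite [dot (b + _) _]dot_sqrD.
  have -> : dot q k = - (2 * K0) * dot b (a *m k).
    by rewrite /q dotZl -/b -dot_mulmxr.
  have : dot (a *m k) (a *m k) <= al ^+ 2 * dot k k.
    rewrite -!enorm_sqr -exprMn ler_pXn2r ?nnegrE ?enorm_ge0//.
    by rewrite mulr_ge0 ?enorm_ge0// ltW.
  rewrite -(ler_pM2l K00) mulrA -/K.
  move: (dot b b) (dot b _) (dot (a *m k) _) (dot k k) (K * _) => *; lra.
(* The lower paraboloid of slope [q] and the upper affine bound of slope [e] touch at [k = 0]. *)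
have qe : q - e = 0.
  apply: (@linear_le_quadratic _ _ _ K r1) => // k kr.
  have [iek] := lower k kr; have := logvol_le_base iek.
  rewrite [e + k]addrC addrK dotDl dotNl (dotC k e); lra.
exists r1, K; split=> //; first by rewrite mulr_gt0// exprn_gt0.
by move=> k /lower; have -> : q = e by apply/eqP; rewrite -subr_eq0 qe.
Qed.

(** Let [k = g e - e] and [y = g^-T e]. The supergradient [y] against the lower paraboloid gives
    [<e - y, d - k> <= K |d|^2] for small [d]; take [d - k] parallel to [e - y] and of norm [|k|],
    so that [|d| <= 2 |k|]. *)
Lemma contragredient_lipschitz_base : exists r L, [/\ 0 < r, 0 < L &
  forall g, cone_aut g -> enorm (g *m e - e) <= r ->
    enorm ((invmx g)^T *m e - e) <= L * enorm (g *m e - e)].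
Proof.
have [r [K [r0 K0 low]]] := logvol_ge_base.
exists (r / 2), (4 * K); split; [by rewrite divr_gt0|by rewrite mulr_gt0|].
move=> g ag kr; set k := g *m e - e; rewrite -/k in kr; set y := _ *m e.
have key d : enorm d <= r -> dot (e - y) (d - k) <= K * dot d d.
  move=> dr; have [ied H1] := low d dr.
  have := logvol_le ag ied; rewrite -/y.
  have -> : e + d - g *m e = d - k by rewrite /k opprB addrCA addrA.
  have ige : icone (g *m e) by exact: cone_aut_icone.
  have := logvol_le_base ige; rewrite logvolE// -/k.
  move: H1; rewrite !dot_bilin !(dotC _ e) !(dotC _ y); lra.
have [ey|ey] := eqVneq (e - y) 0.
  by rewrite -enormN opprB ey enorm0 mulr_ge0 ?mulr_ge0 ?enorm_ge0// ltW.
have en : 0 < enorm (e - y) by rewrite enorm_gt0.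
have [k0|k0] := eqVneq k 0.
  exfalso; move/eqP: ey; apply; apply: (@linear_le_quadratic _ _ _ K r) => // d dr.
  by have := key d dr; rewrite k0 subr0.
have ek : 0 < enorm k by rewrite enorm_gt0.
pose s := enorm k / enorm (e - y).
have es : enorm (s *: (e - y)) = enorm k.
  by rewrite enormZ ger0_norm ?divfK ?gt_eqF// divr_ge0 ?enorm_ge0.
have kd : enorm (k + s *: (e - y)) <= 2 * enorm k.
  by apply: le_trans (enormD _ _) _; rewrite es; lra.
have := key (k + s *: (e - y)).
rewrite [k + _ - k]addrAC subrr add0r dotZr -enorm_sqr /s expr2 mulrA divfK ?gt_eqF//.
have -> : enorm (k + s *: (e - y)) <= r by lra.
move=> /(_ isT) H; rewrite -[y - e]opprB enormN -(ler_pM2l ek).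
apply: le_trans H _; rewrite -enorm_sqr.
have : enorm (k + s *: (e - y)) ^+ 2 <= (2 * enorm k) ^+ 2.
  by rewrite ler_pXn2r ?nnegrE ?enorm_ge0// mulr_ge0 ?enorm_ge0.
rewrite -(ler_pM2l K0) => /le_trans; apply.
by rewrite le_eqVlt; apply/orP; left; apply/eqP; ring.
Qed.

(** The Lipschitz estimate at distance 0. It makes [star] independent of the choice of [chart]. *)
Lemma contragredient_fix g : cone_aut g -> g *m e = e -> (invmx g)^T *m e = e.
Proof.
move=> ag ge; have [r [L [r0 L0 lip]]] := contragredient_lipschitz_base.
have := lip g ag; rewrite ge subrr enorm0 mulr0 => /(_ (ltW r0)) H.
apply/eqP; rewrite -subr_eq0 -enorm_eq0 eq_le H/=; exact: enorm_ge0.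
Qed.

Lemma starE g : cone_aut g -> star (g *m e) = (invmx g)^T *m e.
Proof.
move=> ag; have [ac ce] := chartP (cone_aut_icone ag e_icone).
rewrite /star; set c := chart _ in ac ce *.
have [gu _ _] := ag; have [cu _ _] := ac.
have fixe : invmx g *m c *m e = e by rewrite -mulmxA ce mulKmx.
have := contragredient_fix (cone_autM (cone_autV ag) ac) fixe.
have gc : invmx g *m c \in unitmx by rewrite unitmx_mul unitmx_inv gu.
have -> : invmx c = invmx (invmx g *m c) *m invmx g.
  by apply: (can_inj (mulKmx gc)); rewrite mulKVmx// -mulmxA mulmxV// mulmx1.
by move=> H; rewrite trmx_mul -mulmxA H.
Qed.

Lemma star_icone w : icone w -> icone (star w).
Proof.
move=> iw; have [ac ce] := chartP iw.
by apply: cone_aut_icone e_icone; apply: cone_aut_tr; exact: cone_autV.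
Qed.

Lemma star_aut g w : cone_aut g -> icone w -> star (g *m w) = (invmx g)^T *m star w.
Proof.
move=> ag iw; have [ac ce] := chartP iw.
have [gu _ _] := ag; have [cu _ _] := ac.
rewrite -{1}ce mulmxA starE; last exact: cone_autM.
have gc : g *m chart w \in unitmx by rewrite unitmx_mul gu.
have -> : invmx (g *m chart w) = invmx (chart w) *m invmx g.
  by apply: (can_inj (mulKmx gc)); rewrite mulmxV// mulmxA mulmxK// mulmxV.
by rewrite trmx_mul -mulmxA.
Qed.

Lemma starK w : icone w -> star (star w) = w.
Proof.
move=> iw; have [ac ce] := chartP iw.
rewrite {2}/star starE; last by apply: cone_aut_tr; exact: cone_autV.
by rewrite -trmx_inv invmxK trmxK.
Qed.

Lemma star_base : star e = e.
Proof.
by have := starE cone_aut1; rewrite mul1mx invmx1 trmx1 mul1mx.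
Qed.

(* This is [logdet k + logdet k^-1 = 0] for [k = g^-1 h] combined with the
   support inequality at [e]. *)
Lemma star_antitone w w' : icone w -> icone w' ->
  dot (w - w') (star w - star w') <= 0.
Proof.
move=> iw iw'; have [ac ce] := chartP iw; have [ac' ce'] := chartP iw'.
rewrite -{1}ce -{1}ce' /star; set g := chart w in ac ce *; set h := chart w' in ac' ce' *.
have [gu _ _] := ac; have [hu _ _] := ac'.
have H1 := e_supp (cone_autM (cone_autV ac) ac').
have H2 := e_supp (cone_autM (cone_autV ac') ac).
move: H1 H2; rewrite !logdetM ?logdetV//; try exact: cone_autV.
rewrite !dotDl !dotDr !dotNl !dotNr !dot_contragredient//.
by rewrite ![dot (_ *m e) (_ *m e)]dot_mulmxr !trmxK !mulmxA; lra.
Qed.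

(** The inverse chart of [w] carries the pair to [e] and a nearby point, where
    [contragredient_lipschitz_base] applies. It is used once to move the points and once,
    transposed, to move the images back, hence [be * L0 * be]. *)
Lemma star_lipschitz : exists r L, [/\ 0 < r, 0 < L & forall w w',
  enorm (w - e) <= r -> enorm (w' - e) <= r ->
  [/\ icone w, icone w' & enorm (star w - star w') <= L * enorm (w - w')]].
Proof.
have [rho rho0 deep_rho] := e_icone.
have [r0 [L0 [r00 L00 lip]]] := contragredient_lipschitz_base.
have E0 : 0 < dot e e by rewrite dot_gt0 ?icone_neq0.
have [be be0 gbound] : exists2 be, 0 < be & forall g, cone_aut g ->
    deep (rho / 2) (g *m e) -> forall y, enorm (invmx g *m y) <= be * enorm y.
  exists (dot e e / (rho / 2) / rho); first by rewrite !divr_gt0.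
  move=> g ag gdeep y; apply: le_trans (invmx_op_bound y rho0 deep_rho ag) _.
  rewrite ler_wpM2r ?enorm_ge0// ler_pM2r ?invr_gt0//.
  by rewrite ler_pdivlMr ?divr_gt0// mulrC; exact: contragredient_bound.
(* As [|w' - w| <= 2 r], the second term keeps [g^-1 w'] within [r0] of [e]. *)
pose r := Num.min (rho / 2) (r0 / (2 * be)).
have r_gt0 : 0 < r by rewrite lt_min; apply/andP; split; rewrite divr_gt0// mulr_gt0.
have r_rho : r <= rho / 2 by rewrite ge_min lexx.
have r_r0 : r <= r0 / (2 * be) by rewrite ge_min lexx orbT.
exists r, (be * L0 * be); split=> //.
  exact: mulr_gt0 (mulr_gt0 be0 L00) be0.
move=> w w' wr wr'.
have near_deep z : enorm (z - e) <= r -> deep (rho / 2) z.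
  move=> zr; have := deep_perturb deep_rho (le_trans zr r_rho).
  by rewrite subrKC; apply: deepW; lra.
have near_icone z : enorm (z - e) <= r -> icone z.
  by move=> /near_deep; exists (rho / 2) => //; rewrite divr_gt0.
have [iw iw'] := (near_icone _ wr, near_icone _ wr').
split=> //; have [ag ge] := chartP iw; set g := chart w in ag ge.
have [gu _ _] := ag.
have gB : forall y, enorm (invmx g *m y) <= be * enorm y.
  by apply: gbound => //; rewrite ge; exact: near_deep.
have gtB := op_bound_tr (ltW be0) gB.
pose v := invmx g *m w'.
have iv : icone v by apply: cone_aut_icone iw'; exact: cone_autV.
have [ah he] := chartP iv.
have ve : v - e = invmx g *m (w' - w) by rewrite mulmxBr -[in RHS]ge mulKmx.
have vr : enorm (v - e) <= r0.
  rewrite ve; apply: le_trans (gB _) _.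
  have : enorm (w' - w) <= 2 * r.
    have -> : w' - w = (w' - e) - (w - e) by rewrite opprB addrA subrK.
    by apply: le_trans (enormB _ _) _; lra.
  rewrite ler_pdivlMr in r_r0; last exact: mulr_gt0.
  by move: (enorm (w' - w)) => z; nra.
have -> : star w - star w' = - ((invmx g)^T *m (star v - e)).
  rewrite mulmxBr -star_aut// /v mulKVmx// opprB.
  by congr (_ - _); rewrite -ge starE.
rewrite enormN; apply: le_trans (gtB _) _.
rewrite -mulrA -mulrA ler_pM2l//; have := lip _ ah; rewrite he => /(_ vr).
move=> H; apply: le_trans H _; rewrite ler_pM2l// ve.
by rewrite -[w - w']opprB enormN.
Qed.

(** [chart] need not be continuous, so [u] is sought in a whole coset of the stabilizer of [e]. The
    pairs whose coset fails form a compact set [S]; none of them fixes [e], since [k = p^-1] would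
    give [<d, d> <= <d, d> / 2]. Their distance from [e] is thus bounded below. *)
Lemma near_base_transporter (d : 'cV[R]_n) : d != 0 -> exists2 eta, 0 < eta &
  forall y, icone y -> enorm (y - e) <= eta ->
  exists u : 'M[R]_n, [/\ cone_aut u, u *m e = y & dot d d / 2 <= dot (u *m d) d].
Proof.
move=> d0; have dd : 0 < dot d d by exact: dot_gt0.
have [r [B [r0 near_deep SP]]] := aut_pairs_near.
pose fixer := [set k | cone_aut k /\ k *m e = e].
pose S := aut_pairs B `&`
  \bigcap_(k in fixer) [set p : 'M[R]_n * 'M[R]_n | dot (p.1 *m k *m d) d <= dot d d / 2].
have c1 := @entry_continuous_fst R n n 'M[R]_n.
have cdist : continuous
    (fun p : 'M[R]_n * 'M[R]_n => dot (p.1 *m e - e) (p.1 *m e - e)).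
  by apply: continuous_dot; apply: entry_continuousB;
    try apply: entry_continuousM; try exact: entry_continuous_cst.
have clS : compact S.
  apply: compact_closedI; first exact: aut_pairs_compact.
  apply: closed_bigI => k _; apply: closed_le_cst; apply: continuous_dot.
    by do 2 (apply: entry_continuousM; last exact: entry_continuous_cst).
  exact: entry_continuous_cst.
suff [eta [eta0 etar etaS]] : exists eta, [/\ 0 < eta, eta <= r &
    forall p, S p -> eta < enorm (p.1 *m e - e)].
  exists eta => // y iy yeta; have [ag ge] := chartP iy.
  apply: contrapT => /forallNP H.
  have := etaS (chart y, invmx (chart y)); rewrite /= ge ltNge yeta.
  suff H' : S (chart y, invmx (chart y)) by move=> /(_ H').
  split; first by apply: SP; rewrite ?ge// (le_trans yeta).
  move=> k [ak ke] /=; rewrite leNgt; apply/negP => /ltW Hk.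
  apply: (H (chart y *m k)); split=> //; first exact: cone_autM.
  by rewrite -mulmxA ke.
have [S0|] := pselect (S !=set0); last first.
  by move=> S0; exists r; split=> // p Sp; exfalso; apply: S0; exists p.
have [p [Pp Fp] pmin] := continuous_min_exists S0 clS cdist.
have [ap _] := aut_pairsP Pp.
have pe : p.1 *m e - e != 0.
  apply/eqP => /eqP; rewrite subr_eq0 => /eqP pe.
  have [pu _ _] := ap.
  have := Fp (invmx p.1); rewrite /= mulmxV// mul1mx.
  suff F : fixer (invmx p.1) by move=> /(_ F); lra.
  by split; [exact: cone_autV|rewrite -{1}pe mulKmx].
rewrite -enorm_gt0 in pe.
exists (Num.min r (enorm (p.1 *m e - e) / 2)); split.
- by rewrite lt_min r0 divr_gt0.
- by rewrite ge_min lexx.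
- move=> s Ss; rewrite gt_min; apply/orP; right.
  have := pmin s Ss; rewrite -!enorm_sqr ler_pXn2r ?nnegrE ?enorm_ge0//.
  by apply: lt_le_trans; lra.
Qed.

(* If d = x - z were nonzero, [star] would be almost affine around some point near [e]
   in the direction d; after moving that point to [e], antitonicity between
   [e + p] and [star (e - p)] gives [star (e + p) ~ e - p] for some p ~ s d, and
   the minimality inequality at the corresponding h fails. *)
Lemma stationary_eq x z : icone x -> icone z ->
  (forall h, cone_aut h -> dot x e + dot z e <= dot (h *m x) e + dot z (invmx h *m e)) ->
  x = z.
Proof.
move=> ix iz xzmin; pose d := x - z.
apply/eqP; rewrite -subr_eq0; apply/negPn/negP => d0.
have [eta1 eta10 near1] := near_base_transporter d0.
have [r [L [r0 L0 lip]]] := star_lipschitz.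
have [rho rho0 deep_rho] := e_icone.
have ed : 0 < enorm d by rewrite enorm_gt0.
have dd : 0 < dot d d by rewrite dot_gt0.
(* Keeps the segment in the Lipschitz ball and its image under [star] within [eta1] of [e]. *)
pose T := Num.min (r / enorm d) (eta1 / (L * enorm d)).
have T0 : 0 < T.
  by rewrite lt_min; apply/andP; split; apply: divr_gt0 => //; exact: mulr_gt0.
have Tr : T * enorm d <= r by rewrite -ler_pdivlMr// ge_min lexx.
have Teta : L * (T * enorm d) <= eta1.
  by rewrite mulrCA -ler_pdivlMr ?mulr_gt0// ge_min lexx orbT.
pose l t := e + t *: d; pose c t := star (l t).
have lr t : 0 <= t <= T -> enorm (l t - e) <= r.
  move=> /andP[t0 tT]; rewrite /l [e + _]addrC addrK enormZ ger0_norm//.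
  by apply: le_trans Tr; rewrite ler_pM2r.
have c_lip a b : 0 <= a <= T -> 0 <= b <= T -> enorm (c a - c b) <= (L * enorm d) * `|a - b|.
  move=> /lr ar /lr br; have [_ _] := lip _ _ ar br; rewrite -/(c a) -/(c b).
  have -> : l a - l b = (a - b) *: d by rewrite /l scalerBl opprD addrACA subrr add0r.
  by rewrite enormZ; move/le_trans; apply; rewrite mulrAC mulrA.
pose be := (enorm e + r) / rho.
have be0 : 0 < be by apply: divr_gt0 => //; rewrite ltr_wpDl// enorm_ge0.
pose M := enorm x * be.
have M0 : 0 <= M by apply: mulr_ge0; [exact: enorm_ge0|exact: ltW].
(* Small enough for the final contradiction [M * eps < <d, d> / 2]. *)
pose eps := dot d d / (4 * (M + 1)).
have eps0 : 0 < eps by apply: divr_gt0 => //; lra.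
have [m [s [s0 ms0 msT cm]]] := lipschitz_almost_affine T0 c_lip eps0.
have mT : 0 <= m <= T by lra.
have mpT : 0 <= m + s <= T by lra.
have mmT : 0 <= m - s <= T by lra.
have il t : 0 <= t <= T -> icone (l t).
  by move=> /lr tr; have [] := lip _ _ tr tr.
(* Since [u] sends [e] to [star (l m)], its transpose [g] sends [l m] to [e], and [<d, g d>] stays
   at least [<d, d> / 2]. *)
have [u [au ue ud]] : exists u : 'M[R]_n,
    [/\ cone_aut u, u *m e = c m & dot d d / 2 <= dot (u *m d) d].
  apply: near1; first exact/star_icone/il.
  rewrite -[X in _ - X]star_base; apply: le_trans Teta.
  have [|_ _] := lip _ e (lr _ mT); first by rewrite subrr enorm0 ltW.
  move/le_trans; apply; rewrite ler_pM2l// /l [e + _]addrC addrK enormZ.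
  by have /andP[? ?] := mT; rewrite ger0_norm// ler_pM2r.
have [uu up ui] := au.
pose g := u^T; have ag : cone_aut g by exact: cone_aut_tr.
have gl : g *m l m = e.
  rewrite -[l m]starK; last exact: il.
  by rewrite -/(c m) -ue starE// /g trmx_inv mulKVmx// unitmx_tr.
have lm_u : (invmx u)^T *m e = l m.
  by rewrite -starE// ue starK//; exact: il.
have iuB y : enorm (invmx u *m y) <= be * enorm y.
  apply: le_trans (invmx_op_bound y rho0 deep_rho au) _.
  rewrite ler_wpM2r ?enorm_ge0// ler_pM2r ?invr_gt0// lm_u.
  rewrite -[l m](subrKC e); apply: le_trans (enormD _ _) _.
  by rewrite lerD2l lr.
have star_g w : icone w -> star (g *m w) = invmx u *m star w.
  by move=> iw; rewrite star_aut// /g trmx_inv trmxK.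
have gls t : g *m l (m + t) = e + t *: (g *m d).
  have -> : l (m + t) = l m + t *: d by rewrite /l scalerDl addrA.
  by rewrite mulmxDr gl scalemxAr.
set p := s *: (g *m d).
have wpE : g *m l (m + s) = e + p by rewrite gls.
have wmE : g *m l (m - s) = e - p by rewrite gls scaleNr.
have iwp : icone (e + p) by rewrite -wpE; apply: cone_aut_icone => //; exact: il.
have iwm : icone (e - p) by rewrite -wmE; apply: cone_aut_icone => //; exact: il.
pose a := e - star (e + p); pose b := star (e - p) - e.
have ab : enorm (a - b) <= be * (eps * s).
  have -> : a - b = - (invmx u *m (c (m + s) + c (m - s) - 2 *: c m)).
    rewrite mulmxBr mulmxDr -!star_g; try exact: il.
    rewrite wpE wmE -scalemxAr -star_g ?gl ?star_base; last exact: il.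
    by rewrite /a /b; apply/colP => i; rewrite !mxE; ring.
  rewrite enormN; apply: le_trans (iuB _) _.
  by rewrite ler_pM2l.
(* Antitonicity reads [<(p - a) + (a - b), p - a> <= 0], so [|p - a| <= |a - b|]. *)
have pa : enorm (p - a) <= be * (eps * s).
  have := star_antitone iwp (star_icone iwm); rewrite starK//.
  have -> : e + p - star (e - p) = (p - a) + (a - b).
    by rewrite /b; apply/colP => i; rewrite !mxE; ring.
  have -> : star (e + p) - (e - p) = p - a.
    by rewrite /a; apply/colP => i; rewrite !mxE; ring.
  rewrite dotDl -enorm_sqr => H.
  have := dot_ge_enorm (a - b) (p - a); move: H ab.
  have := enorm_ge0 (p - a); rewrite le_eqVlt => /predU1P[<- _ ab _|q0 H1 H2 H3].
    exact: le_trans (enorm_ge0 _) ab.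
  rewrite -(ler_pM2r q0) -expr2; nra.
(* Minimality at [h = k^-1], where [k e = e + p]: it says [<x, a> <= <z, p>]. *)
have dp : dot d p <= dot x (p - a).
  have [k ak ke] := C_homog e_icone iwp; have [ku _ _] := ak.
  have := xzmin _ (cone_autV ak); rewrite invmxK ke.
  rewrite dot_mulmxl -starE// ke.
  have -> : star (e + p) = e - a by rewrite /a subKr.
  by rewrite /d !dot_bilin; lra.
have : dot d p = s * dot (u *m d) d by rewrite /p dotZr /g -dot_mulmxl dotC.
have := dot_le_enorm x (p - a).
have : s * (dot d d / 2) <= s * dot (u *m d) d by rewrite ler_pM2l.
have : enorm x * enorm (p - a) <= M * (eps * s).
  by rewrite /M -mulrA; apply: ler_wpM2l => //; exact: enorm_ge0.
have : M * eps < dot d d / 2.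
  rewrite /eps mulrA ltr_pdivrMr; last by lra.
  by have := dd; nra.
rewrite -(ltr_pM2r s0) => H1 H2 H3 H4 H5.
by have := dp; lra.
Qed.

Lemma self_scaled_base x z : icone x -> icone z ->
  exists2 g, cone_aut g & g *m x = (invmx g)^T *m z.
Proof.
move=> ix iz; have [rho rho0 deep_rho] := e_icone.
have [rx rx0 deep_x] := ix; have [rz rz0 deep_z] := iz.
pose V := dot x e + dot z e.
have V0 : 0 <= V by apply: addr_ge0; apply: cone_dot_ge0; exact: iconeW.
(* Both terms of [phi] are nonnegative; where [phi <= V], the first bounds [g] through [g x] and the
   second bounds [g^-1] through [g^-1 e]. *)
pose B1 := V / rho / rx; pose B2 := V / rz / rho.
have B10 : 0 <= B1 by rewrite !divr_ge0 ?(ltW rho0) ?(ltW rx0).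
have B20 : 0 <= B2 by rewrite !divr_ge0 ?(ltW rho0) ?(ltW rz0).
pose phi (p : 'M[R]_n * 'M[R]_n) := dot (p.1 *m x) e + dot z (p.2 *m e).
pose S := aut_pairs (B1 + B2) `&` [set p | phi p <= V].
have SP g : cone_aut g -> phi (g, invmx g) <= V -> S (g, invmx g).
  move=> ag gV; split=> //; move: gV; rewrite /phi/= => gV; have [gu gp gi] := ag.
  have g1 : 0 <= dot (g *m x) e.
    by apply: cone_dot_ge0; [apply/gp/iconeW|exact: iconeW].
  have g2 : 0 <= dot z (invmx g *m e).
    by apply: cone_dot_ge0; [exact: iconeW|apply/gi/iconeW].
  apply: aut_pairs_mem => // y.
    apply: le_trans (positive_op_bound y rx0 deep_x gp) _.
    rewrite ler_wpM2r ?enorm_ge0//; apply: (@le_trans _ _ B1); last by lra.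
    rewrite /B1 ler_pM2r ?invr_gt0// ler_pdivlMr// mulrC.
    apply: le_trans (deep_rho _ (gp _ (iconeW ix))) _.
    by rewrite dotC; lra.
  apply: le_trans (positive_op_bound y rho0 deep_rho gi) _.
  rewrite ler_wpM2r ?enorm_ge0//; apply: (@le_trans _ _ B2); last by lra.
  rewrite /B2 ler_pM2r ?invr_gt0// ler_pdivlMr// mulrC.
  by apply: le_trans (deep_z _ (gi _ (iconeW e_icone))) _; lra.
have c1 := @entry_continuous_fst R n n 'M[R]_n.
have c2 := @entry_continuous_snd R n n 'M[R]_n.
have cphi : continuous phi.
  have cp1 : continuous (fun p : 'M[R]_n * 'M[R]_n => dot (p.1 *m x) e).
    apply: continuous_dot; last exact: entry_continuous_cst.
    by apply: entry_continuousM; last exact: entry_continuous_cst.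
  have cp2 : continuous (fun p : 'M[R]_n * 'M[R]_n => dot z (p.2 *m e)).
    apply: continuous_dot; first exact: entry_continuous_cst.
    by apply: entry_continuousM; last exact: entry_continuous_cst.
  by move=> p; apply: cvgD; [exact: cp1|exact: cp2].
have clS : compact S.
  by apply: compact_closedI; [exact: aut_pairs_compact|exact: closed_le_cst].
have [|[g h] [Pgh ghV] ghmin] := continuous_min_exists _ clS cphi.
  exists (1%:M, 1%:M); have := SP _ cone_aut1.
  by rewrite invmx1; apply; rewrite /phi/= !mul1mx.
have [/= ag gh] := aut_pairsP Pgh; have [gu gp gi] := ag.
have {}ghmin k : cone_aut k -> phi (g, h) <= phi (k *m g, h *m invmx k).
  move=> ak; have [ku _ _] := ak; have akg := cone_autM ak ag.
  have -> : h *m invmx k = invmx (k *m g).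
    have kg : k *m g \in unitmx by rewrite unitmx_mul ku.
    by apply: (can_inj (mulKmx kg)); rewrite mulmxV// -gh mulmxA mulmxK// mulmxV.
  (* Outside the sublevel set [phi] exceeds [V], which already dominates the minimum. *)
  have [kV|/ltW kV] := leP (phi (k *m g, invmx (k *m g))) V; last exact: le_trans kV.
  by apply: ghmin; exact: SP.
exists g => //; apply: stationary_eq.
- exact: cone_aut_icone.
- by apply: cone_aut_icone iz; apply: cone_aut_tr; exact: cone_autV.
- move=> k ak; have := ghmin k ak; rewrite /phi/= gh.
  by rewrite [dot (h^T *m z) _]dot_mulmxl [dot (h^T *m z) _]dot_mulmxl trmxK !mulmxA.
Qed.

End BasePoint.

Lemma self_scaled u x z : icone u -> icone x -> icone z ->
  exists2 g, cone_aut g & g *m x = (invmx g)^T *m z.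
Proof.
by move=> /base_point_exists[e ie e_supp]; exact: (self_scaled_base ie e_supp).
Qed.

End SelfDualCone.

(** * Lyapunov forms *)

Section ConeDynamics.
Variables (R : realType) (n : nat) (C : set 'cV[R]_n).
Hypothesis C_dualE : forall y, C y <-> forall x, C x -> 0 <= dot y x.
Implicit Types A F P : 'M[R]_n.

(** As [<y, x> = 0], dividing [0 <= <y, exp (t A) x>] by [t] leaves the first-order term when
    [t -> 0]. *)
Lemma invariant_dynamics_cross_positive A :
  invariant_dynamics C A -> cross_positive C A.
Proof.
move=> invA x y Cx Cy yx0; have [K K0 expK] := dot_expmx_le A x y.
rewrite -oppr_le0; apply: (@le_of_le_linear_error _ _ _ K) => t t0 t1.
have := expK t t0 t1; rewrite yx0 add0r expr2 -mulrA -mulrDr.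
have := cone_dot_ge0 C_dualE Cy (invA x Cx t (ltW t0)) => H1 /(le_trans H1).
by rewrite pmulr_rge0//; lra.
Qed.

(** If [F^T v = 0], then [v] is orthogonal to [F C = C], which contains both [s e] and [s e + v] for
    [s = |v| / rho]; hence [<v, v> = 0]. *)
Lemma Aut_cone_cone_aut F e : icone C e -> Aut_cone C F -> cone_aut C F.
Proof.
move=> [rho rho0 deep_e] FC.
have Fp : positive C F by move=> x Cx; rewrite -FC; exists x.
have Fonto x : C x -> exists2 y, C y & F *m y = x by rewrite -{1}FC.
have Funit : F \in unitmx.
  apply: unitmx_tr_inj => v Fv; apply/eqP; rewrite -dot_eq0.
  have dot0 x : C x -> dot v x = 0.
    by move=> /Fonto[y _ <-]; rewrite dot_mulmxr Fv dotC dot0r.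
  pose s := enorm v / rho.
  have s0 : 0 <= s by rewrite divr_ge0 ?enorm_ge0// ltW.
  have deep_se : deep C (s * rho) (s *: e).
    by move=> x Cx; rewrite dotZl -mulrA ler_wpM2l// deep_e.
  have Cse h : enorm h <= enorm v -> C (s *: e + h).
    by move=> hv; apply: (deep_ball C_dualE deep_se); rewrite /s divfK ?gt_eqF.
  have := dot0 _ (Cse v (lexx _)); rewrite dotDr dot0 ?add0r => [->//|].
  by rewrite -[_ *: e]addr0; apply: Cse; rewrite enorm0 enorm_ge0.
by split=> // x /Fonto[y Cy <-]; rewrite mulKmx.
Qed.

Lemma cone_aut_Aut_cone P : cone_aut C P -> Aut_cone C P.
Proof.
move=> [Pu Pp Pi]; apply/seteqP; split=> [_ [x Cx <-]|x Cx]; first exact: Pp.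
by exists (invmx P *m x); [exact: Pi|rewrite mulKVmx].
Qed.

Lemma hurwitz_unitmx A lam : hurwitz A -> 0 <= lam -> lam%:M - A \in unitmx.
Proof.
move=> hA lam0; apply/negPn/negP => nu.
have /hA : eigenvalue (map_mx (real_complex R) A) (real_complex R lam).
  rewrite eigenvalue_map /eigenvalue /eigenspace kermx_eq0 row_free_unit.
  apply: contra nu => nu; rewrite -opprB -scaleN1r unitmxZ// unitrN1.
  by [].
by rewrite /= ltNge lam0.
Qed.

End ConeDynamics.

Theorem theorem3 (R : realType) (n : nat) (C : set 'cV[R]_n)
    (C_proper : proper_cone C)
    (C_homogeneous : homogeneous_cone C)
    (C_self_dual : self_dual C)
    (A : 'M[R]_n) (A_inv : invariant_dynamics C A) (A_hurwitz : hurwitz A) :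
  exists P : 'M[R]_n,
    [/\ P^T = P, Aut_cone C P & lyapunov_form A P].
Proof.
(* In dimension 0 there is no nonzero vector, so both definiteness conditions are vacuous. *)
have [n0|n_gt0] := posnP n.
  subst n; exists 1%:M; split; first exact: trmx1.
    by rewrite /Aut_cone/= (_ : mulmx 1%:M = id) ?image_id//; apply/funext => x; rewrite mul1mx.
  by split=> x; rewrite [x]flatmx0 eqxx.
have C_dualE y : C y <-> forall x, C x -> 0 <= dot y x by rewrite -{1}C_self_dual.
have [_ _ _ _ [e /(icone_interior C_dualE) e_icone]] := C_proper.
have C_homog x y : icone C x -> icone C y -> exists2 g, cone_aut C g & g *m x = y.
  move=> /(icone_interior C_dualE) ix /(icone_interior C_dualE) iy.
  have [g Cg gx] := C_homogeneous x y ix iy.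
  by exists g => //; exact: Aut_cone_cone_aut e_icone Cg.
have cA := invariant_dynamics_cross_positive C_dualE A_inv.
have Aunit lam := hurwitz_unitmx A_hurwitz (lam := lam).
have ATunit lam : 0 <= lam -> lam%:M - A^T \in unitmx.
  by move=> lam0; rewrite -tr_scalar_mx -linearB/= unitmx_tr Aunit.
have [x ix iAx] := cross_positive_descent C_dualE e_icone cA Aunit.
have [z iz iAz] := cross_positive_descent C_dualE e_icone (cross_positive_tr cA) ATunit.
have scaled := self_scaled C_dualE C_homog n_gt0 e_icone ix iz.
have [P [PT aP Ppos Pneg]] := cross_positive_lyapunov C_dualE cA ix iAx iz iAz scaled.
exists P; split=> //; first exact: cone_aut_Aut_cone.
by split=> y y0; [have := Ppos y y0|have := Pneg y y0]; rewrite /dot mulmxA.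
Qed.
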